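(* Let $m,n\ge1$ be integers. There exists a constant $K_0$, determined only by $m$ and $n$, such that $\mathcal{C}(E)\le K_0$ for every finite set $E\subset\mathbb{R}^n$, where $\mathcal{C}(E)$ is the complexity of $E$ defined in the context.
   Context: Function space. $C^{m-1,1}(\mathbb{R}^n)$ is the space of $C^{m-1}$ functions $F:\mathbb{R}^n\to\mathbb{R}$ whose $(m-1)$-st order partial derivatives are Lipschitz, with seminorm $\|F\|=\sup_{x\ne y}\big(\sum_{|\alpha|=m-1}\frac{(\partial^\alpha F(x)-\partial^\alpha F(y))^2}{|x-y|^2}\big)^{1/2}$. $J_xF$ denotes the degree $\le m-1$ Taylor polynomial of $F$ at $x$. Polynomials. $\mathcal{P}$ is the vector space of real polynomials of degree at most $m-1$ on $\mathbb{R}^n$; $D=\dim\mathcal{P}$. For $x\in\mathbb{R}^n$, $\delta>0$: $\langle P,Q\rangle_x=\sum_{|\alpha|\le m-1}\frac1{\alpha!}\partial^\alpha P(x)\partial^\alpha Q(x)$; $\tau_{x,\delta}:\mathcal{P}\to\mathcal{P}$, $\tau_{x,\delta}(P)(z)=\delta^{-m}P(x+\delta(z-x))$; $\langle P,Q\rangle_{x,\delta}=\langle\tau_{x,\delta}P,\tau_{x,\delta}Q\rangle_x$; $\mathcal{B}_{x,\delta}$ is the closed unit ball of the corresponding norm $|\cdot|_{x,\delta}$. For $h\in\mathbb{R}^n$, $T_h(P)(z)=P(z-h)$. Transversality. For a set $A\subset\mathcal{P}$ and a subspace $V\subset\mathcal{P}$, $A/V$ is the image of $A$ in the quotient space $\mathcal{P}/V$.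 A closed symmetric ($\Omega=-\Omega$) convex set $\Omega\subset\mathcal{P}$ is $(x,\delta,R)$-transverse to $V$ (where $R\ge1$) if $\mathcal{B}_{x,\delta}/V\subset R\cdot(\Omega\cap\mathcal{B}_{x,\delta})/V$ and $\Omega\cap V\subset R\cdot\mathcal{B}_{x,\delta}$. A subspace $V\subset\mathcal{P}$ is DTI if $T_h\tau_{x,\delta}V=V$ for all $x,h\in\mathbb{R}^n$, $\delta>0$. For a finite set $E\subset\mathbb{R}^n$ and $x\in\mathbb{R}^n$, $\sigma(x)=\sigma(x,E)=\{J_x\varphi:\varphi\in C^{m-1,1}(\mathbb{R}^n),\ \varphi=0\text{ on }E,\ \|\varphi\|\le1\}$, a closed symmetric convex subset of $\mathcal{P}$. Constants. $c_1\in(0,1]$ and $R_0\ge1$ are fixed constants depending only on $m,n$ (such constants exist) with the following properties. (i) For every finite $E\subset\mathbb{R}^n$, every subspace $V\subset\mathcal{P}$, all $x,y\in\mathbb{R}^n$, $\delta>0$, $R\ge1$: if $\sigma(x)$ is $(x,\delta,R)$-transverse to $V$ and $|x-y|\le c_1\delta/R$, then $\sigma(y)$ is $(y,\delta,8R)$-transverse to $V$. (ii) For every finite $E\subset\mathbb{R}^n$ and every $(x,\delta)\in\mathbb{R}^n\times(0,\infty)$ there is a DTI subspace $V$ such that $\sigma(x)$ is $(x,\delta,R_0)$-transverse to $V$. Set $R_{\rm label}=8R_0$, $R_{\rm med}=256\,D\,R_{\rm label}$, $R_{\rm big}=10^mR_{\rm med}$, $C_*=20\,c_1^{-1}R_{\rm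 big}$. Complexity. For an interval $I\subset\mathbb{R}$ let $l(I),r(I)$ be its left and right endpoints; write $J<I$ (equivalently $I>J$) if either $r(J)<l(I)$, or $r(J)=l(I)$ and $l(J)<l(I)$. For a ball $B\subset\mathbb{R}^n$ and $x\in B$, let $K_x(B)$ be the largest integer $K\ge1$ (understood as $+\infty$ if there are arbitrarily large such $K$) for which there exist intervals $I_1>I_2>\cdots>I_K$ in $(0,C_*\operatorname{diam}(B)]$ (with endpoints in this set) and subspaces $V_1,\dots,V_K\subset\mathcal{P}$ such that, for all $k=1,\dots,K$, $\tau_{x,r(I_k)}(\sigma(x))$ is $(x,1,R_{\rm label})$-transverse to $V_k$ but $\tau_{x,l(I_k)}(\sigma(x))$ is not $(x,1,256\,D\,R_{\rm label})$-transverse to $V_k$; if no such $K$ exists, $K_x(B)=0$. The local complexity of $E$ on $B$ is $\mathcal{C}(E|B)=\sup_{x\in B}K_x(B)$. The complexity of $E$ is $\mathcal{C}(E)=\mathcal{C}(E|5B_0)$, where $B_0$ is a compact ball containing $E$ (for definiteness, the one of minimal radius) and $5B_0$ is the concentric ball with five times the radius. *)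

(* Defs.v *)
(* multinomials must be imported before the analysis files: in the other order
   their notations clash. *)
From HB Require Import structures.
From mathcomp Require Import all_boot all_order all_algebra.
From mathcomp.multinomials Require Import mpoly.
From mathcomp Require Import boolp classical_sets functions cardinality.
From mathcomp Require Import reals ereal topology normedtype derive.

Set Implicit Arguments.
Unset Strict Implicit.
Unset Printing Implicit Defensive.

Import Order.TTheory GRing.Theory Num.Theory.
Import numFieldNormedType.Exports.

Local Open Scope classical_set_scope.
Local Open Scope ring_scope.

(* The space P of real polynomials of degree at most m - 1 in n variables, as
   a finite-dimensional vector space (msize is 1 + the degree, and 0 at 0). *)

Section PolySpace.
Context (R : realType) (m n : nat).

Definition deg_lt : pred {mpoly R[n]} := fun p => (msize p <= m)%N.

Fact deg_lt_submod_closed : submod_closed deg_lt.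
Proof.
split=> [|c p q]; rewrite /in_mem /= /deg_lt; first by rewrite msize0.
move=> sp sq; apply: leq_trans (msizeD_le _ _) _.
by rewrite geq_max sq andbT (leq_trans (msizeZ_le _ _)).
Qed.

HB.instance Definition _ :=
  GRing.isSubmodClosed.Build R {mpoly R[n]} deg_lt deg_lt_submod_closed.

Record polysp := PolySp { mpoly_of_polysp :> {mpoly R[n]};
                          _ : mpoly_of_polysp \in deg_lt }.

HB.instance Definition _ := [isSub for mpoly_of_polysp].
HB.instance Definition _ := [Choice of polysp by <:].
HB.instance Definition _ := [SubChoice_isSubLmodule of polysp by <:].

Lemma msize_polysp (p : polysp) : (msize p <= m)%N.
Proof. by case: p. Qed.

Let coefs (p : polysp) : 'rV[R]_#|{: 'X_{1..n < m}}| :=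
  \row_i (p : {mpoly R[n]})@_(enum_val i : 'X_{1..n < m}).

Fact polysp_vector_axiom : Vector.axiom #|{: 'X_{1..n < m}}| polysp.
Proof.
exists coefs.
  by move=> c p q; apply/rowP=> i; rewrite !mxE /= mcoeffD mcoeffZ.
have sz (v : 'rV[R]_#|{: 'X_{1..n < m}}|) :
    \sum_(a : 'X_{1..n < m}) v 0 (enum_rank a) *: 'X_[a] \in deg_lt.
  apply: rpred_sum => a _; apply: rpredZ.
  by rewrite /in_mem /= /deg_lt msizeX bmdeg.
have coef (f : 'X_{1..n < m} -> R) (b : 'X_{1..n < m}) :
    (\sum_(a : 'X_{1..n < m}) f a *: 'X_[R, a])@_b = f b.
  rewrite raddf_sum /= (bigD1 b) //= mcoeffZ mcoeffX eqxx mulr1 big1 ?addr0 //.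
  by move=> a /negbTE ab; rewrite mcoeffZ mcoeffX -bmeqP ab mulr0.
exists (fun v => PolySp (sz v)) => [p|v].
  apply/val_inj => /=; rewrite [RHS](mpolywE (msize_polysp p)).
  by apply: eq_bigr => a _; rewrite mxE enum_rankK.
by apply/rowP=> i; rewrite mxE /= coef enum_valK.
Qed.

HB.instance Definition _ := Lmodule_hasFinDim.Build R polysp polysp_vector_axiom.

End PolySpace.

Lemma msizeM_leq (R : realType) n (p q : {mpoly R[n]}) (c d : nat) :
  (msize p <= c.+1)%N -> (msize q <= d.+1)%N -> (msize (p * q) <= (c + d).+1)%N.
Proof.
move=> pc qd; have [->|p0] := eqVneq p 0; first by rewrite mul0r msize0.
have [->|q0] := eqVneq q 0; first by rewrite mulr0 msize0.
rewrite msizeM // -subn1 leq_subLR.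
by rewrite add1n -addnS -addSn leq_add.
Qed.

Lemma msize_prod_lin (R : realType) n k (lq : n.-tuple {mpoly R[k]})
    (a : 'X_{1..n}) :
  (forall i, (msize (tnth lq i) <= 2)%N) ->
  (msize (\prod_(i < n) tnth lq i ^+ a i) <= (mdeg a).+1)%N.
Proof.
move=> slq.
have sX (i : 'I_n) d : (msize (tnth lq i ^+ d) <= d.+1)%N.
  elim: d => [|d IHd]; first by rewrite expr0 msize1.
  by rewrite exprS; exact: (msizeM_leq (slq i) IHd).
rewrite mdegE; elim/big_rec2: _ => [|i d p _ IHp]; first by rewrite msize1.
exact: msizeM_leq.
Qed.

Lemma deg_lt_comp (R : realType) m n (lq : n.-tuple {mpoly R[n]})
    (p : polysp R m n) :
  (forall i, (msize (tnth lq i) <= 2)%N) -> p \mPo lq \in @deg_lt R m n.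
Proof.
move=> slq; rewrite (comp_mpolywE _ (msize_polysp p)).
apply: rpred_sum => a _; apply: rpredZ.
exact: leq_trans (msize_prod_lin _ slq) (bmdeg a).
Qed.

Section Polynomials.
Context (R : realType) (m n : nat).
Implicit Types (x h : 'rV[R]_n) (d : R) (P Q : polysp R m n).

Definition dilation_subst x d : n.-tuple {mpoly R[n]} :=
  [tuple (x 0 i)%:MP + d *: ('X_i - (x 0 i)%:MP) | i < n].

Definition translation_subst h : n.-tuple {mpoly R[n]} :=
  [tuple 'X_i - (h 0 i)%:MP | i < n].

Lemma msize_translation_subst h i :
  (msize (tnth (translation_subst h) i) <= 2)%N.
Proof.
rewrite tnth_mktuple; apply: leq_trans (msizeD_le _ _) _.
by rewrite msizeN geq_max msizeX mdeg1 msizeC; case: eqP.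
Qed.

Lemma msize_dilation_subst x d i : (msize (tnth (dilation_subst x d) i) <= 2)%N.
Proof.
rewrite tnth_mktuple; apply: leq_trans (msizeD_le _ _) _.
rewrite geq_max msizeC; apply/andP; split; first by case: eqP.
have := msize_translation_subst x i; rewrite tnth_mktuple.
exact/leq_trans/msizeZ_le.
Qed.

Fact tau_subproof x d P :
  d ^- m *: (P \mPo dilation_subst x d) \in @deg_lt R m n.
Proof. by apply/rpredZ/deg_lt_comp => i; exact: msize_dilation_subst. Qed.

(* tau x d P (z) = d^-m P (x + d (z - x)) *)
Definition tau x d P : polysp R m n := PolySp (tau_subproof x d P).

Fact translate_subproof h P : P \mPo translation_subst h \in @deg_lt R m n.
Proof. by apply: deg_lt_comp => i; exact: msize_translation_subst. Qed.

(* translate h P (z) = P (z - h) *)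
Definition translate h P : polysp R m n := PolySp (translate_subproof h P).

Definition mfact (a : 'X_{1..n}) : nat := \prod_(i < n) (a i)`!.

Definition dotp x P Q : R :=
  \sum_(a : 'X_{1..n < m})
    (mfact a)%:R^-1 * P^`M[a].@[x 0] * Q^`M[a].@[x 0].

Definition sdotp x d P Q : R := dotp x (tau x d P) (tau x d Q).

Definition snorm x d P : R := Num.sqrt (sdotp x d P P).

Definition sball x d : set (polysp R m n) := [set P | snorm x d P <= 1].

End Polynomials.

Section Transversality.
Context (R : realType) (m n : nat).
Implicit Types (A Omega : set (polysp R m n)) (V : {vspace polysp R m n}).

(* The quotient by V is the set of cosets P + V; quot_image V A is A / V. *)
Definition quot_image V A : set (set (polysp R m n)) :=
  [set [set Q | Q - P \in V] | P in A].

Definition scale_set (r : R) A : set (polysp R m n) := [set r *: P | P in A].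

(* Only used when r >= 1 and Omega is closed, symmetric and convex. *)
Definition transverse (x : 'rV[R]_n) (d r : R) Omega V : Prop :=
  quot_image V (sball x d)
    `<=` quot_image V (scale_set r (Omega `&` sball x d))
  /\ Omega `&` [set` V] `<=` scale_set r (sball x d).

Definition DTI V : Prop :=
  forall (x h : 'rV[R]_n) (d : R), 0 < d ->
    [set translate h (tau x d P) | P in [set` V]] = [set` V].

End Transversality.

Section Functions.
Context (R : realType) (n : nat).
Implicit Types (x y : 'rV[R]_n) (F : 'rV[R]_n -> R).

(* The library's norm on 'rV[R]_n is the sup norm. *)
Definition enorm x : R := Num.sqrt (\sum_i x 0 i ^+ 2).

Definition partial (i : 'I_n) F : 'rV[R]_n -> R :=
  fun x => 'D_(delta_mx 0 i) F x.

(* The order of differentiation is that of the variables; it is immaterial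
   for the C^(m-1) functions and orders at most m - 1 considered below. *)
Definition mpartial (a : 'X_{1..n}) F : 'rV[R]_n -> R :=
  foldr (fun i G => iter (a i) (partial i) G) F (enum 'I_n).

Fixpoint Cfun (k : nat) F : Prop :=
  if k is k'.+1 then
    continuous F /\
    forall i : 'I_n,
      (forall x, derivable F x (delta_mx 0 i)) /\ Cfun k' (partial i F)
  else continuous F.

Definition Clip (m : nat) F : Prop :=
  Cfun m.-1 F /\
  forall a : 'X_{1..n}, mdeg a = m.-1 ->
    exists L : R, forall x y,
      `|mpartial a F x - mpartial a F y| <= L * enorm (x - y).

Definition Clip_seminorm (m : nat) F : \bar R :=
  ereal_sup
    [set (Num.sqrt
       (\sum_(a : 'X_{1..n < m} | mdeg a == m.-1)
          (mpartial a F z.1 - mpartial a F z.2) ^+ 2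
            / enorm (z.1 - z.2) ^+ 2))%:E
    | z in [set z : 'rV[R]_n * 'rV[R]_n | z.1 <> z.2]].

Fact jet_subproof (m : nat) x F :
  \sum_(a : 'X_{1..n < m})
     (mpartial a F x / (mfact a)%:R) *:
       \prod_(i < n) ('X_i - (x 0 i)%:MP) ^+ a i \in @deg_lt R m n.
Proof.
apply: rpred_sum => a _; apply: rpredZ; apply: leq_trans (bmdeg a).
have := msize_prod_lin a (msize_translation_subst x).
by under eq_bigr => i _ do rewrite tnth_mktuple.
Qed.

Definition jet (m : nat) x F : polysp R m n := PolySp (jet_subproof m x F).

Definition sigma (m : nat) (E : set 'rV[R]_n) x : set (polysp R m n) :=
  [set jet m x F | F in [set F | [/\ Clip m F,
                                     (forall e, E e -> F e = 0)
                                   & (Clip_seminorm m F <= 1)%E]]].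

End Functions.

Arguments sigma {R n} m E x.

Section Complexity.
Context (R : realType) (m n : nat) (c1 R0 : R).
Implicit Types (E B : set 'rV[R]_n).

Definition R_label : R := 8 * R0.
Definition R_med : R := 256 * (\dim {: polysp R m n})%:R * R_label.
Definition R_big : R := 10 ^+ m * R_med.
Definition Cstar : R := 20 * c1^-1 * R_big.

Definition diam B : R := sup [set enorm (z.1 - z.2) | z in B `*` B].

(* An interval I is encoded by its pair of endpoints (l(I), r(I)). *)
Definition interval_lt (J I : R * R) : Prop :=
  J.2 < I.1 \/ (J.2 = I.1 /\ J.1 < I.1).

Definition complexity_chain E x B (K : nat) : Prop :=
  exists (I : 'I_K -> R * R) (V : 'I_K -> {vspace polysp R m n}),
  [/\ forall k, [/\ 0 < (I k).1, (I k).1 <= (I k).2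
                  & (I k).2 <= Cstar * diam B],
      forall j k : 'I_K, (j < k)%N -> interval_lt (I k) (I j)
    & forall k,
        transverse x 1 R_label (tau x (I k).2 @` sigma m E x) (V k) /\
        ~ transverse x 1 R_med (tau x (I k).1 @` sigma m E x) (V k)].

(* K_x(B); the empty chain (K = 0) gives the value 0 when no K >= 1 is
   admissible, and +oo is the value when arbitrarily large K are. *)
Definition pointwise_complexity E B x : \bar R :=
  ereal_sup [set K%:R%:E | K in [set K | complexity_chain E x B K]].

Definition local_complexity E B : \bar R :=
  ereal_sup [set pointwise_complexity E B x | x in B].

Definition cball (c : 'rV[R]_n) (r : R) : set 'rV[R]_n :=
  [set x | enorm (x - c) <= r].

(* A pair (center, radius); unique unless E is empty, in which case the
   radius is 0 and the center arbitrary. *)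
Definition minimal_ball E (b : 'rV[R]_n * R) : Prop :=
  [/\ 0 <= b.2, E `<=` cball b.1 b.2
    & forall c r, 0 <= r -> E `<=` cball c r -> b.2 <= r].

Definition complexity E : \bar R :=
  let B0 := get (minimal_ball E) in local_complexity E (cball B0.1 (5 * B0.2)).

End Complexity.

(* Main.v *)
Require Import Defs.
From HB Require Import structures.
From mathcomp Require Import all_boot all_order all_algebra.
From mathcomp Require Import perm ring lra.
From mathcomp.multinomials Require Import mpoly.
From mathcomp Require Import boolp classical_sets functions cardinality.
From mathcomp Require Import reals ereal topology normedtype derive.

Set Implicit Arguments.
Unset Strict Implicit.
Unset Printing Implicit Defensive.

Import Order.TTheory GRing.Theory Num.Theory.
Import numFieldNormedType.Exports.

Local Open Scope classical_set_scope.
Local Open Scope ring_scope.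

(** Fix [x]. In the coordinates of [coordp], the scaled derivatives at [x], the
    form [dotp x] is the standard dot product and [tau x d] is the diagonal
    matrix of the powers [t ^+ (m - |a|)], where [t = d^-1]. The set
    [sigma m E x] becomes an absolutely convex set [Om], and a chain of
    intervals becomes a sequence of parameters [t] between which the dilated set
    passes from being transverse to a subspace [V_k] to not being transverse to
    it, even with a constant larger by a factor [256 D]. The number of such
    passages is bounded in terms of the dimension, the exponents and the
    constant only ([chain_bound]).

    The factor [256 D] allows an ellipsoid to replace [Om]: vectors of [Om] that
    span a nearly maximal volume are the rows of a matrix [G] such that [Om]
    contains the points [c *m G] with [|c| <= 1] and consists of such points with
    [|c| <= 2 D] ([ellipsoid_exists]). Let [X] be the Gram matrix of the dilated
    rows; its entries are polynomials in [t]. Up to constants, transversality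
    to [V] consists of two lower bounds on quadratic forms: [(nu + X)^-1] is
    bounded below on [V], so that the part of the set in [V] is bounded
    ([resolvent_lower], [resolvent_upper]), and [X / (nu + X)] is bounded below
    on the orthogonal complement of [V], so that the set covers a ball modulo [V]
    ([coresolvent_lower], [coresolvent_upper]).

    Both forms are bounded above, so the lower bounds survive small changes of
    the subspace. By compactness of the Grassmannian the subspaces [V_k] fall
    into finitely many classes ([orthoproj_classes]), and within a class a single
    subspace may be used ([alternation_count_close]). For a fixed subspace the
    form is a quotient [A / p] of polynomials in [t] of bounded degree. When its
    least eigenvalue passes a level [c], the polynomial [\det (A - c p)] vanishes
    ([form_crossing]); for a suitable [c] between the two thresholds it is not
    identically zero, so its degree bounds the number of passages
    ([alternation_count]). *)

(** * Quadratic forms on row vectors *)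

Section QuadraticForms.
Context (R : realFieldType).

Definition dot N (u v : 'rV[R]_N) : R := (u *m v^T) 0 0.

Definition sqn N (u : 'rV[R]_N) : R := dot u u.

Definition form N (A : 'M[R]_N) (u : 'rV[R]_N) : R := dot (u *m A) u.

Lemma dotE N (u v : 'rV[R]_N) : dot u v = \sum_i u 0 i * v 0 i.
Proof. by rewrite /dot mxE; apply: eq_bigr => i _; rewrite mxE. Qed.

Lemma dotC N (u v : 'rV[R]_N) : dot u v = dot v u.
Proof. by rewrite !dotE; apply: eq_bigr => i _; rewrite mulrC. Qed.

Lemma dotDl N (u v w : 'rV[R]_N) : dot (u + v) w = dot u w + dot v w.
Proof. by rewrite /dot mulmxDl mxE. Qed.

Lemma dotDr N (u v w : 'rV[R]_N) : dot w (u + v) = dot w u + dot w v.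
Proof. by rewrite !(dotC w) dotDl. Qed.

Lemma dotNl N (u w : 'rV[R]_N) : dot (- u) w = - dot u w.
Proof. by rewrite /dot mulNmx mxE. Qed.

Lemma dotNr N (u w : 'rV[R]_N) : dot w (- u) = - dot w u.
Proof. by rewrite !(dotC w) dotNl. Qed.

Lemma dotZl N a (u w : 'rV[R]_N) : dot (a *: u) w = a * dot u w.
Proof. by rewrite /dot -scalemxAl mxE. Qed.

Lemma dotZr N a (u w : 'rV[R]_N) : dot w (a *: u) = a * dot w u.
Proof. by rewrite !(dotC w) dotZl. Qed.

Lemma dot_mull N M (u : 'rV[R]_N) (A : 'M_(N, M)) (v : 'rV[R]_M) :
  dot (u *m A) v = dot u (v *m A^T).
Proof. by rewrite /dot trmx_mul trmxK mulmxA. Qed.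

Lemma sqn_ge0 N (u : 'rV[R]_N) : 0 <= sqn u.
Proof. by rewrite /sqn dotE sumr_ge0 // => i _; rewrite -expr2 sqr_ge0. Qed.

Lemma sqn_eq0 N (u : 'rV[R]_N) : sqn u = 0 -> u = 0.
Proof.
rewrite /sqn dotE => /eqP; rewrite psumr_eq0; last first.
  by move=> i _; rewrite -expr2 sqr_ge0.
move/allP => h; apply/rowP => i; rewrite mxE; apply/eqP.
by have := h i; rewrite mem_index_enum -expr2 sqrf_eq0 => /(_ isT).
Qed.

Lemma sqn0 N : sqn (0 : 'rV[R]_N) = 0.
Proof. by rewrite /sqn /dot mul0mx mxE. Qed.

Lemma sqnZ N a (u : 'rV[R]_N) : sqn (a *: u) = a ^+ 2 * sqn u.
Proof. by rewrite /sqn dotZl dotZr mulrA expr2. Qed.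

Lemma coord_sqr_le N (u : 'rV[R]_N) i : u 0 i ^+ 2 <= sqn u.
Proof.
rewrite /sqn dotE (bigD1 i) //= -expr2 lerDl sumr_ge0 // => j _.
by rewrite -expr2 sqr_ge0.
Qed.

Lemma formDmx N (A B : 'M[R]_N) u : form (A + B) u = form A u + form B u.
Proof. by rewrite /form mulmxDr dotDl. Qed.

Lemma formNmx N (A : 'M[R]_N) u : form (- A) u = - form A u.
Proof. by rewrite /form mulmxN dotNl. Qed.

Lemma formZmx N a (A : 'M[R]_N) u : form (a *: A) u = a * form A u.
Proof. by rewrite /form -scalemxAr dotZl. Qed.

Lemma form_scalar N a (u : 'rV[R]_N) : form a%:M u = a * sqn u.
Proof. by rewrite /form mul_mx_scalar dotZl. Qed.

Lemma form_conj N M (P : 'M[R]_(N, M)) A u :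
  form (P *m A *m P^T) u = form A (u *m P).
Proof. by rewrite /form !mulmxA dot_mull trmxK. Qed.

Lemma form_gram N M (P : 'M[R]_(N, M)) u : form (P *m P^T) u = sqn (u *m P).
Proof. by rewrite /form mulmxA dot_mull trmxK. Qed.

Lemma formZ N (A : 'M[R]_N) a u : form A (a *: u) = a ^+ 2 * form A u.
Proof. by rewrite /form -scalemxAl dotZl dotZr mulrA expr2. Qed.

Lemma form_bound N (A : 'M[R]_N) u :
  `|form A u| <= (\sum_i \sum_j `|A i j|) * sqn u.
Proof.
have -> : form A u = \sum_j \sum_i u 0 i * A i j * u 0 j.
  by rewrite /form dotE; apply: eq_bigr => j _; rewrite mxE mulr_suml.
rewrite exchange_big /= mulr_suml; apply: le_trans (ler_norm_sum _ _ _) _.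
apply: ler_sum => i _; rewrite mulr_suml.
apply: le_trans (ler_norm_sum _ _ _) _; apply: ler_sum => j _.
rewrite !normrM mulrAC mulrC ler_wpM2l //.
have := coord_sqr_le u i; have := coord_sqr_le u j.
rewrite -(real_normK (num_real (u 0 i))) -(real_normK (num_real (u 0 j))) => hi hj.
have := sqr_ge0 (`|u 0 i| - `|u 0 j|); nra.
Qed.

Section Semidefinite.
Context (N : nat) (A : 'M[R]_N) (symA : A^T = A) (psdA : forall u, 0 <= form A u).

Lemma sym_dot u v : dot (u *m A) v = dot (v *m A) u.
Proof. by rewrite dot_mull symA dotC. Qed.

Lemma formD u v : form A (u + v) = form A u + 2 * dot (u *m A) v + form A v.
Proof.
by rewrite /form mulmxDl !dotDl !dotDr (sym_dot v u); ring.
Qed.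

Lemma form_cauchy u v : dot (u *m A) v ^+ 2 <= form A u * form A v.
Proof.
have fl a b : 0 <= a ^+ 2 * form A u + 2 * a * b * dot (u *m A) v
                   + b ^+ 2 * form A v.
  have := psdA (a *: u + b *: v); rewrite formD !formZ -scalemxAl dotZl dotZr.
  by congr (_ <= _); ring.
have := psdA u; have := psdA v.
set b := dot _ _ in fl *; set p := form A u in fl *; set q := form A v in fl *.
move=> q0 p0; have [q_gt0|] := ltP 0 q.
  have := fl q (- b); rewrite !expr2 => h.
  have : 0 <= q * (p * q - b * b) by nra.
  by rewrite pmulr_rge0 // subr_ge0.
move=> q_le0; have qE : q = 0 by lra.
rewrite qE mulr0; have := fl (- b) (p + 1); rewrite qE.
have := sqr_ge0 b; rewrite !expr2; nra.
Qed.

Lemma form_add_le u v : form A (u + v) <= 2 * form A u + 2 * form A v.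
Proof.
have := psdA (u - v); rewrite !formD dotNr -[- v]scaleN1r formZ; lra.
Qed.

(** For semidefinite [A] the bound [|uA|^4 <= form A u * form A (uA)] gives
    [|uA|^2 <= C * form A u], so [A] is coercive as soon as it is invertible. *)
Lemma psd_unit_coercive : A \in unitmx ->
  exists2 e, 0 < e & forall u, e * sqn u <= form A u.
Proof.
move=> uA; pose C := \sum_i \sum_j `|A i j|; pose I := invmx A *m (invmx A)^T.
pose C' := \sum_i \sum_j `|I i j|.
have C0 : 0 <= C by apply: sumr_ge0 => i _; apply: sumr_ge0.
have C'0 : 0 <= C' by apply: sumr_ge0 => i _; apply: sumr_ge0.
have h1 u : sqn (u *m A) <= C * form A u.
  have := form_cauchy u (u *m A); rewrite -/(sqn _).
  have := le_trans (ler_norm _) (form_bound A (u *m A)); rewrite -/C.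
  have := sqn_ge0 (u *m A); have := psdA u; have := psdA (u *m A).
  set s := sqn _; set f := form A u; set g := form A _ => g0 f0 s0 gs sq.
  have [s_gt0|] := ltP 0 s; last by move=> ?; apply: le_trans (mulr_ge0 _ _).
  rewrite -(ler_pM2l s_gt0) -expr2 (le_trans sq) //.
  by rewrite (_ : s * (C * f) = f * (C * s)) ?ler_wpM2l //; ring.
have h2 u : sqn u <= C' * sqn (u *m A).
  have := le_trans (ler_norm _) (form_bound I (u *m A)).
  by rewrite form_gram mulmxK.
exists (C' * C + 1)^-1; first by rewrite invr_gt0; nra.
move=> u; rewrite mulrC ler_pdivrMr; last by nra.
have := h1 u; have := h2 u; have := psdA u; have := sqn_ge0 (u *m A); nra.
Qed.

End Semidefinite.

Lemma dot_cauchy N (u v : 'rV[R]_N) : dot u v ^+ 2 <= sqn u * sqn v.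
Proof.
have h (w : 'rV[R]_N) : form 1%:M w = sqn w by rewrite form_scalar mul1r.
have := @form_cauchy N 1%:M (trmx1 _ _) _ u v.
rewrite !h mulmx1; apply=> w; rewrite h; exact: sqn_ge0.
Qed.

Lemma sqnD N (u v : 'rV[R]_N) : sqn (u + v) <= 2 * sqn u + 2 * sqn v.
Proof.
have h (w : 'rV[R]_N) : form 1%:M w = sqn w by rewrite form_scalar mul1r.
have := @form_add_le N 1%:M (trmx1 _ _) _ u v.
by rewrite !h; apply=> w; rewrite h; exact: sqn_ge0.
Qed.

Lemma coercive_unit N (A : 'M[R]_N) e : 0 < e ->
  (forall u, e * sqn u <= form A u) -> A \in unitmx.
Proof.
move=> e0 h; rewrite -row_free_unit; apply/row_freeP.
have : kermx A = 0.
  apply/row_matrixP => i; rewrite row0; apply: sqn_eq0; apply/eqP.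
  have := h (row i (kermx A)); rewrite /form -row_mul mulmx_ker row0.
  have := sqn_ge0 (row i (kermx A)); rewrite /dot mul0mx mxE.
  by move=> s0; rewrite pmulr_rle0 // => s1; apply/eqP/le_anti/andP; split.
move=> k0; have : row_free A by rewrite -kermx_eq0 k0.
by move/row_freeP.
Qed.

End QuadraticForms.

(** * Orthogonal projections *)

Section Projections.
Context (R : realFieldType) (N : nat).

Definition orthoproj (P : 'M[R]_N) : Prop := P^T = P /\ P *m P = P.

(** The projection is [B^T *m (B *m B^T)^-1 *m B] for a basis [B] of the rows. *)
Lemma orthoproj_exists (U : 'M[R]_N) :
  exists2 P, orthoproj P & forall v : 'rV[R]_N, (v <= U)%MS <-> v *m P = v.
Proof.
have [r [B fB eqB]] : exists r, exists2 B : 'M_(r, N), row_free B & (B :=: U)%MS.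
  by exists (\rank U), (row_base U); [exact: row_base_free | exact: eq_row_base].
pose G := B *m B^T.
have uG : G \in unitmx.
  rewrite -row_free_unit -kermx_eq0; apply/eqP/row_matrixP => i.
  rewrite row0; apply: (row_free_inj fB); rewrite mul0mx.
  apply: sqn_eq0; rewrite /sqn dot_mull -mulmxA -/G dotC.
  by rewrite -row_mul mulmx_ker row0 /dot mul0mx mxE.
have symG : G^T = G by rewrite /G trmx_mul trmxK.
exists (B^T *m invmx G *m B); first split.
- by rewrite !trmx_mul trmxK trmx_inv symG mulmxA.
- by rewrite !mulmxA -(mulmxA _ B B^T) -/G mulmxKV.
move=> v; rewrite -eqB; split => [/submxP[c ->]|<-].
  by rewrite !mulmxA -(mulmxA c B B^T) -/G mulmxK.
by rewrite mulmxA submxMl.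
Qed.

Variable P : 'M[R]_N.
Hypothesis oP : orthoproj P.

Lemma orthoproj_idem (u : 'rV[R]_N) : u *m P *m P = u *m P.
Proof. by case: oP => _ PP; rewrite -mulmxA PP. Qed.

Lemma orthoproj_compl : orthoproj (1%:M - P).
Proof.
case: oP => symP PP; split; first by rewrite linearB /= trmx1 symP.
by rewrite mulmxBr mulmx1 mulmxBl mul1mx PP subrr subr0.
Qed.

Lemma orthoproj_entry i j : `|P i j| <= 1.
Proof.
case: oP => symP PP.
have PE : P i i = \sum_k P i k ^+ 2.
  rewrite -{1}PP mxE; apply: eq_bigr => k _.
  by rewrite -[P in X in _ * X]symP mxE expr2.
have le k : P i k ^+ 2 <= P i i.
  by rewrite [leRHS]PE (bigD1 k) //= lerDl sumr_ge0 // => l _; exact: sqr_ge0.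
have := le i; have := le j; rewrite -(real_normK (num_real (P i j))) => h1 h2.
have h3 : P i i <= 1 by nra.
by rewrite -(@expr_le1 _ 2) //; apply: le_trans h1 h3.
Qed.

Lemma orthoproj_pythagoras (u : 'rV[R]_N) :
  sqn u = sqn (u *m P) + sqn (u *m (1%:M - P)).
Proof.
have [cs cP] := orthoproj_compl; case: (oP) => symP PP.
have := @form_gram R N N P u; have := @form_gram R N N (1%:M - P) u.
rewrite cs cP symP PP => <- <-.
by rewrite -formDmx addrC subrK form_scalar mul1r.
Qed.

End Projections.

(** * Polynomial families of quadratic forms *)

Section PolynomialForms.
Context (R : realType).

Definition evmx M N (A : 'M[{poly R}]_(M, N)) (t : R) : 'M[R]_(M, N) :=
  map_mx (horner_eval t) A.

Lemma det_evmx N (A : 'M[{poly R}]_N) t : \det (evmx A t) = (\det A).[t].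
Proof. by rewrite det_map_mx. Qed.

Lemma evmx_cont N (A : 'M[{poly R}]_N) (s e : R) : 0 < e ->
  exists2 d, 0 < d & forall t, `|t - s| < d ->
    forall u, `|form (evmx A t) u - form (evmx A s) u| <= e * sqn u.
Proof.
move=> e0; pose e' := e / (N * N).+1%:R.
have e'0 : 0 < e' by rewrite divr_gt0 // ltr0n.
have : \forall t \near s, forall ij : 'I_N * 'I_N,
    `|(A ij.1 ij.2).[t] - (A ij.1 ij.2).[s]| <= e'.
  apply: (filter_forall (F := nbhs s)) => ij.
  have /cvgrPdist_le := @continuous_horner R (A ij.1 ij.2) s.
  by move=> /(_ e' e'0); apply: filterS => t; rewrite distrC.
move=> /nbhs_ballP[d /= d0 dP]; exists d => // t td u.
rewrite -formNmx -formDmx (le_trans (form_bound _ _)) // ler_wpM2r ?sqn_ge0 //.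
have le i j : `|(evmx A t - evmx A s) i j| <= e'.
  have := dP t _ (i, j); rewrite !mxE /horner_eval /=; apply.
  by rewrite /ball /= distrC.
apply: (@le_trans _ _ (\sum_(i < N) \sum_(j < N) e')).
  by do 2 (apply: ler_sum => ? _); exact: le.
rewrite !sumr_const !card_ord -mulrnA -mulr_natr /e' mulrAC ler_pdivrMr ?ltr0n //.
by rewrite ler_wpM2l ?ler_nat // ltW.
Qed.

(** The parameters up to which the form stays semidefinite have a supremum; at
    the supremum the form is semidefinite and, unless it is singular, coercive,
    so that it would stay semidefinite a little longer. *)
Lemma form_crossing N (A : 'M[{poly R}]_N) (t0 t1 e : R) : A^T = A -> t0 <= t1 ->
  0 < e -> (forall u, e * sqn u <= form (evmx A t0) u) ->
  (exists u, form (evmx A t1) u < 0) ->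
  exists2 t, t0 < t < t1 & root (\det A) t.
Proof.
move=> symA t01 e0 coer0 [u1 neg1].
have symE t : (evmx A t)^T = evmx A t by rewrite /evmx map_trmx symA.
pose psd t := forall u, 0 <= form (evmx A t) u.
pose S := [set t | t0 <= t <= t1 /\ forall t', t0 <= t' <= t -> psd t'].
have psd0 : psd t0 by move=> u; apply: le_trans (coer0 u); have := sqn_ge0 u; nra.
have S0 : S t0.
  split; first by rewrite lexx.
  by move=> t' /le_anti <-.
have supS : has_sup S by split; [exists t0 | exists t1 => t [/andP[_ ?] _]].
set s := sup S.
have t0s : t0 <= s by exact: sup_upper_bound.
have st1 : s <= t1 by apply: ge_sup; [exists t0 | move=> t [/andP[_ ?] _]].
have lts t : t0 <= t -> t < s -> psd t.
  move=> t0t /(sup_gt (ex_intro _ _ S0))[t' [_ ht'] tt'].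
  by apply: ht'; rewrite t0t ltW.
have psds : psd s.
  move=> u; rewrite leNgt; apply/negP => fu.
  have [s_t0|t0_s] := eqVneq s t0; first by have := psd0 u; rewrite -s_t0; lra.
  have lt0s : t0 < s by rewrite lt_neqAle eq_sym t0_s.
  have su := sqn_ge0 u.
  pose d' := - form (evmx A s) u / (2 * (sqn u + 1)).
  have d'0 : 0 < d' by apply: divr_gt0; lra.
  have [d d0 dP] := evmx_cont A s d'0.
  pose t := Num.max t0 (s - d / 2).
  have ts : t < s by rewrite gt_max lt0s /=; lra.
  have t0t : t0 <= t by rewrite le_max lexx.
  have tst : s - d / 2 <= t by rewrite le_max lexx orbT.
  have := dP t _ u; have -> : `|t - s| < d by rewrite ltr_norml; lra.
  move=> /(_ isT); have := lts t t0t ts u.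
  have : d' * sqn u < - form (evmx A s) u.
    by rewrite /d' mulrAC ltr_pdivrMr; [nra | lra].
  by rewrite ler_norml; lra.
have s_t1 : s != t1 by apply/eqP => st; have := psds u1; rewrite st; lra.
have lst1 : s < t1 by rewrite lt_neqAle s_t1.
have nunit : evmx A s \notin unitmx.
  apply/negP => us; have [e' e'0 coer] := psd_unit_coercive (symE s) psds us.
  have [d d0 dP] := evmx_cont A s e'0.
  pose t := Num.min t1 (s + d / 2).
  have ts : s < t by rewrite lt_min lst1 /=; lra.
  have tt1 : t <= t1 by rewrite ge_min lexx.
  have tst : t <= s + d / 2 by rewrite ge_min lexx orbT.
  suff : S t by move/(sup_upper_bound supS); rewrite -/s; lra.
  split; first by lra.
  move=> t' /andP[t0t' t't]; have [/(lts _ t0t')//|st'] := ltP t' s.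
  move=> u; have := dP t' _ u; have -> : `|t' - s| < d by rewrite ltr_norml; lra.
  by move=> /(_ isT); have := coer u; rewrite ler_norml; lra.
exists s; last by rewrite rootE -det_evmx; move: nunit; rewrite unitmxE unitfE negbK.
rewrite lst1 andbT lt_neqAle t0s andbT; apply: contra nunit => /eqP <-.
exact: coercive_unit e0 coer0.
Qed.

End PolynomialForms.

(** * Counting alternations *)

Section Alternations.
Context (R : realType).

Lemma size_mul_leS (p q : {poly R}) a b :
  (size p <= a.+1)%N -> (size q <= b.+1)%N -> (size (p * q)%R <= (a + b).+1)%N.
Proof.
move=> pa qb; apply: leq_trans (size_polyMleq _ _) _.
by rewrite -subn1 leq_subLR add1n -addnS -addSn leq_add.
Qed.

Lemma size_prod_leS (I : finType) (F : I -> {poly R}) s :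
  (forall i, (size (F i) <= s.+1)%N) -> (size (\prod_i F i)%R <= (#|I| * s).+1)%N.
Proof.
move=> sF; rewrite -sum_nat_const.
elim/big_rec2: _ => [|i p q _ IH]; first by rewrite size_poly1.
exact: size_mul_leS.
Qed.

Lemma size_det N (A : 'M[{poly R}]_N) s :
  (forall i j, (size (A i j) <= s.+1)%N) -> (size (\det A) <= (N * s).+1)%N.
Proof.
move=> sA; apply: leq_trans (size_sum _ _ _) _; apply/bigmax_leqP => /= g _.
have := size_prod_leS (fun i => sA i (g i)); rewrite card_ord => sP.
by rewrite -signr_odd; case: odd; rewrite ?expr1 ?expr0 ?mulN1r ?mul1r ?size_polyN.
Qed.

Lemma size_adj N (A : 'M[{poly R}]_N) s i j :
  (forall i j, (size (A i j) <= s.+1)%N) -> (size ((\adj A) i j) <= (N * s).+1)%N.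
Proof.
move=> sA; rewrite mxE /cofactor -signr_odd.
have sd : (size (\det (row' j (col' i A))) <= (N * s).+1)%N.
  have := @size_det _ (row' j (col' i A)) s.
  move/(_ (fun k l => _)) => h; apply: leq_trans (h _) _.
    by move=> k l; rewrite !mxE.
  by rewrite ltnS leq_mul2r leq_pred orbT.
by case: odd; rewrite ?expr1 ?expr0 ?mulN1r ?mul1r ?size_polyN.
Qed.

Lemma avoid_roots (p : {poly R}) (lo hi : R) : p != 0 -> lo < hi ->
  exists2 c, lo < c < hi & ~~ root p c.
Proof.
move=> p0 lohi; pose n := size p.
pose c (i : nat) := lo + (hi - lo) * (i.+1%:R / n.+1%:R).
have c_in i : (i < n)%N -> lo < c i < hi.
  move=> i_n; have : i.+1%:R / n.+1%:R < 1 :> R.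
    by rewrite ltr_pdivrMr ?ltr0n // mul1r ltr_nat ltnS.
  have : 0 < i.+1%:R / n.+1%:R :> R by rewrite divr_gt0 ?ltr0n.
  by rewrite /c; set x := _ / _ => x0 x1; apply/andP; split; nra.
have c_inj : injective c.
  move=> i j /addrI /mulfI h; have {h} := h _; rewrite subr_eq0 gt_eqF //.
  move=> /(_ isT) /mulIf h; have {h} := h _; rewrite invr_eq0 pnatr_eq0.
  by move=> /(_ isT) /eqP; rewrite eqr_nat eqSS => /eqP.
apply: contrapT => h.
have : (n < size p)%N; last by rewrite ltnn.
rewrite -[X in (X < _)%N](size_iota 0) -(size_map c).
apply: max_poly_roots => //; last by rewrite (map_inj_uniq c_inj) iota_uniq.
apply/allP => _ /mapP[i + ->]; rewrite mem_iota add0n => /c_in ci.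
by apply: contrapT => /negP nr; apply: h; exists (c i).
Qed.

(** A constant [c] strictly between the two thresholds and off the spectrum at
    [t = 1] makes [\det (A - c p)] a nonzero polynomial, and every passage from
    [A >= a p] to the failure of [A >= b p] costs it a root. *)
Lemma alternation_count N (A : 'M[{poly R}]_N) (p : {poly R}) s (a b : R)
    (T : finType) (J : {set T}) (t0 t1 : T -> R) :
  A^T = A -> (forall i j, (size (A i j) <= s.+1)%N) -> (size p <= s.+1)%N ->
  (forall t, 0 < t -> 0 < p.[t]) -> b < a ->
  (forall k, k \in J -> 0 < t0 k <= t1 k) ->
  (forall j k, j != k -> t1 j <= t0 k \/ t1 k <= t0 j) ->
  (forall k, k \in J ->
     forall u, a * p.[t0 k] * sqn u <= form (evmx A (t0 k)) u) ->
  (forall k, k \in J ->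
     exists u, form (evmx A (t1 k)) u < b * p.[t1 k] * sqn u) ->
  (#|J| <= N * s)%N.
Proof.
move=> symA sA sp p0 ba t0_gt0 disj sat fail.
pose M := p.[1]^-1 *: evmx A 1.
have p1 : 0 < p.[1] by apply: p0.
have [c /andP[bc ca] cM] := avoid_roots (monic_neq0 (char_poly_monic M)) ba.
pose B := A - (c *: p)%:M.
have evB t : evmx B t = evmx A t - (c * p.[t])%:M.
  apply/matrixP => i j; rewrite !mxE /horner_eval hornerD hornerN.
  by rewrite hornerMn hornerZ.
have detB0 : \det B != 0.
  apply/eqP => dB; move: cM; rewrite -eigenvalue_root_char negbK.
  rewrite /eigenspace kermx_eq0 row_free_unit => uM.
  have : evmx B 1 \in unitmx.
    have -> : evmx B 1 = p.[1] *: (M - c%:M).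
      rewrite evB scalerBr /M scalerA mulfV ?gt_eqF // scale1r.
      by rewrite scale_scalar_mx mulrC.
    by rewrite unitmxZ // unitfE gt_eqF.
  by rewrite unitmxE det_evmx dB horner0 unitr0.
have root_k k : k \in J -> exists t, t0 k < t < t1 k /\ root (\det B) t.
  move=> kJ; have /andP[t0k t01] := t0_gt0 k kJ.
  have ht0 := p0 _ t0k; have ht1 := p0 _ (lt_le_trans t0k t01).
  have [|||u||t tk tr] := @form_crossing R N B (t0 k) (t1 k) ((a - c) * p.[t0 k]).
  - by rewrite /B linearB /= tr_scalar_mx symA.
  - by [].
  - by apply: mulr_gt0; lra.
  - by rewrite evB formDmx formNmx form_scalar; have := sat k kJ u; lra.
  - have [u fu] := fail k kJ; exists u; rewrite evB formDmx formNmx form_scalar.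
    have := sqn_ge0 u; have : (c - b) * p.[t1 k] > 0 by apply: mulr_gt0; lra.
    nra.
  - by exists t.
have /choice[f fP] : forall k, exists t, k \in J -> t0 k < t < t1 k /\ root (\det B) t.
  by move=> k; case: (boolP (k \in J)) => [/root_k[t ?]|_]; [exists t | exists 0].
have sB i j : (size (B i j) <= s.+1)%N.
  rewrite !mxE (leq_trans (size_polyD _ _)) // size_polyN geq_max sA.
  by case: (i == j); rewrite ?mulr1n ?size_poly0 ?(leq_trans (size_scale_leq _ _)).
rewrite -ltnS; apply: leq_trans (size_det sB).
rewrite -[X in (X < _)%N](size_image f).
apply: max_poly_roots => //.
  by apply/allP => _ /mapP[k + ->]; rewrite mem_enum => /fP[].
rewrite map_inj_in_uniq ?enum_uniq // => j k; rewrite !mem_enum => jJ kJ fjk.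
have [/andP[j0 j1] _] := fP j jJ; have [/andP[k0 k1] _] := fP k kJ.
by apply/eqP; apply: contraT => /disj[]; rewrite fjk in j0 j1; lra.
Qed.

End Alternations.

(** * Alternations along subspaces *)

Section Subspaces.
Context (R : realType).

Lemma size_mulmx L M N (A : 'M[{poly R}]_(L, M)) (B : 'M[{poly R}]_(M, N)) a b :
  (forall i j, (size (A i j) <= a.+1)%N) ->
  (forall i j, (size (B i j) <= b.+1)%N) ->
  forall i j, (size ((A *m B) i j) <= (a + b).+1)%N.
Proof.
move=> sA sB i j; rewrite mxE; apply: leq_trans (size_sum _ _ _) _.
by apply/bigmax_leqP => k _; exact: size_mul_leS.
Qed.

Lemma evmx_const M N (A : 'M[R]_(M, N)) t : evmx (map_mx polyC A) t = A.
Proof. by apply/matrixP => i j; rewrite !mxE /horner_eval hornerC. Qed.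

Lemma evmxM L M N (A : 'M[{poly R}]_(L, M)) (B : 'M[{poly R}]_(M, N)) t :
  evmx (A *m B) t = evmx A t *m evmx B t.
Proof. exact: map_mxM. Qed.

Lemma evmxD M N (A B : 'M[{poly R}]_(M, N)) t :
  evmx (A + B) t = evmx A t + evmx B t.
Proof. exact: map_mxD. Qed.

Lemma evmxZ M N p (A : 'M[{poly R}]_(M, N)) t :
  evmx (p *: A) t = p.[t] *: evmx A t.
Proof. by apply/matrixP => i j; rewrite !mxE /horner_eval hornerM. Qed.

(** When the subspaces are close to each other, one of them may replace them
    all: on a vector [u] of one and its projection [u'] to the other the forms
    differ by a factor two and an error [form (u - u')]. The complement of the
    common subspace is then filled with a definite form. *)
Lemma alternation_count_close N (A : 'M[{poly R}]_N) (p : {poly R}) s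
    (lam a b e2 : R) (T : finType) (J : {set T}) (t0 t1 : T -> R)
    (P : T -> 'M[R]_N) :
  A^T = A -> (forall i j, (size (A i j) <= s.+1)%N) -> (size p <= s.+1)%N ->
  (forall t, 0 < t -> 0 < p.[t]) ->
  (forall t, 0 < t -> forall u, 0 <= form (evmx A t) u <= lam * p.[t] * sqn u) ->
  0 <= lam -> 0 < b -> 96 * b < a -> 0 <= e2 <= 1 / 8 -> lam * e2 <= b / 2 ->
  (forall k, orthoproj (P k)) ->
  (forall j k, j \in J -> k \in J ->
     forall u, sqn (u *m (P j - P k)) <= e2 * sqn u) ->
  (forall k, k \in J -> 0 < t0 k <= t1 k) ->
  (forall j k, j != k -> t1 j <= t0 k \/ t1 k <= t0 j) ->
  (forall k, k \in J -> forall u, u *m P k = u ->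
     a * p.[t0 k] * sqn u <= form (evmx A (t0 k)) u) ->
  (forall k, k \in J -> exists2 u, u *m P k = u &
     form (evmx A (t1 k)) u < b * p.[t1 k] * sqn u) ->
  (#|J| <= N * s)%N.
Proof.
move=> symA sA sp p0 bndA lam0 b0 ba /andP[e20 e28] lame oP close t0_gt0 disj sat fail.
have [->|[k0 k0J]] := set_0Vmem J; first by rewrite cards0.
pose Q := P k0; have oQ : orthoproj Q by exact: oP.
have [symQ QQ] := oQ; have [symQc QQc] := orthoproj_compl oQ.
have symE t : (evmx A t)^T = evmx A t by rewrite /evmx map_trmx symA.
have formE t u v : 0 < t -> form (evmx A t) (u + v) <=
    2 * form (evmx A t) u + 2 * form (evmx A t) v.
  by move=> ht; apply: form_add_le (symE t) _ _ _ => w; case/andP: (bndA t ht w).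
(* [u - u *m P k] is short, so its form is a small multiple of [sqn u] *)
have move_form t j k u : j \in J -> k \in J -> 0 < t -> u *m P j = u ->
    form (evmx A t) (u *m P k) <=
      2 * form (evmx A t) u + 2 * (lam * e2 * p.[t] * sqn u)
    /\ sqn u <= 2 * sqn (u *m P k) + 2 * (e2 * sqn u).
  move=> jJ kJ ht uj; pose d := u *m (P j - P k).
  have de : sqn d <= e2 * sqn u by exact: close.
  have uE : u = u *m P k + d by rewrite /d mulmxBr uj addrC subrK.
  have uE' : u *m P k = u + - d by rewrite {2}uE addrK.
  have sN : sqn (- d) = sqn d by rewrite -scaleN1r sqnZ sqrrN expr1n mul1r.
  have fN : form (evmx A t) (- d) = form (evmx A t) d.
    by rewrite -scaleN1r formZ sqrrN expr1n mul1r.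
  have fd : form (evmx A t) d <= lam * e2 * p.[t] * sqn u.
    have /andP[f0 f1] := bndA t ht d; have pt := p0 t ht.
    apply: le_trans f1 _; rewrite (_ : _ * sqn u = lam * p.[t] * (e2 * sqn u)).
      by rewrite ler_wpM2l // mulr_ge0 // ltW.
    by ring.
  split; first by rewrite {1}uE' (le_trans (formE _ _ _ ht)) // lerD2l ler_pM2l // fN.
  by rewrite {1}uE (le_trans (sqnD _ _)) // lerD2l ler_pM2l.
pose A' := map_mx polyC Q *m A *m map_mx polyC Q
           + ((a / 8) *: p) *: map_mx polyC (1%:M - Q).
have formA' t u : form (evmx A' t) u =
    form (evmx A t) (u *m Q) + a / 8 * p.[t] * sqn (u *m (1%:M - Q)).
  rewrite evmxD !evmxM evmxZ !evmx_const formDmx formZmx hornerZ -{2}symQ form_conj.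
  by rewrite -[in RHS]form_gram symQc QQc.
apply: (@alternation_count R N A' p s (a / 8) (8 * b) T J t0 t1) => //.
- rewrite linearD linearZ /= !trmx_mul symA !map_trmx symQ symQc.
  by rewrite mulmxA.
- move=> i j.
  have sC (C : 'M[R]_N) k l : (size (map_mx polyC C k l) <= 1)%N.
    by rewrite mxE size_polyC; case: (_ != 0).
  rewrite mxE (leq_trans (size_polyD _ _)) // geq_max; apply/andP; split.
    have := size_mulmx (size_mulmx (sC Q) sA) (sC Q) i j.
    by rewrite add0n addn0.
  rewrite mxE -[s]addn0; apply: size_mul_leS; last exact: sC.
  by rewrite (leq_trans (size_scale_leq _ _)).
- by lra.
- move=> k kJ u; have /andP[tk _] := t0_gt0 k kJ; have pt := p0 _ tk.
  rewrite formA' (orthoproj_pythagoras oQ u) mulrDr lerD2r.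
  have := orthoproj_idem oQ u; move: (u *m Q) => {}u uQ.
  have [h1 h2] := move_form _ k0 k u k0J kJ tk uQ.
  have := sat k kJ (u *m P k); rewrite orthoproj_idem // => /(_ erefl) h3.
  have := sqn_ge0 u; have := sqn_ge0 (u *m P k); move: h1 h2 h3.
  set f := form _ u; set g := form _ (u *m _); set q := p.[_] in pt *.
  set x := sqn (u *m _); set y := sqn u => h1 h2 h3 x0 y0.
  have hx : 3 / 8 * y <= x by nra.
  have hg : a * q * (3 / 8 * y) <= g.
    by apply: le_trans h3; apply: ler_wpM2l => //; apply: mulr_ge0; lra.
  have : lam * e2 * q * y <= b / 2 * q * y.
    by do 2 (apply: ler_wpM2r => //); exact: ltW.
  have : b * (q * y) <= a / 96 * (q * y).
    by apply: ler_wpM2r; [apply: mulr_ge0 => //; exact: ltW | lra].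
  have : 0 <= a * (q * y) by apply: mulr_ge0; [lra | apply: mulr_ge0 => //; exact: ltW].
  by lra.
- move=> k kJ; have /andP[tk t01] := t0_gt0 k kJ.
  have tk1 := lt_le_trans tk t01; have pt := p0 _ tk1.
  have [u uP fu] := fail k kJ; exists (u *m Q).
  rewrite formA' orthoproj_idem // mulmxBr mulmx1 orthoproj_idem // subrr sqn0 mulr0.
  rewrite addr0.
  have [h1 h2] := move_form _ k k0 u kJ k0J tk1 uP.
  move: h1 h2 fu (sqn_ge0 u) (sqn_ge0 (u *m Q)); rewrite -/Q.
  set f := form _ u; set g := form _ (u *m _); set q := p.[_] in pt *.
  set x := sqn (u *m _); set y := sqn u => h1 h2 h3 y0 x0.
  have hx : y <= 8 / 3 * x by nra.
  have : lam * e2 * q * y <= b / 2 * q * y.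
    by do 2 (apply: ler_wpM2r => //); exact: ltW.
  have : b * q * y <= b * q * (8 / 3 * x).
    by apply: ler_wpM2l => //; apply: mulr_ge0; lra.
  by lra.
Qed.

(** Orthogonal projections have bounded entries: rounding the entries sorts the
    subspaces into finitely many classes of nearby ones. *)
Lemma orthoproj_classes N (e2 : R) : 0 < e2 ->
  exists (C : finType) (cl : 'M[R]_N -> C), forall P Q,
    orthoproj P -> orthoproj Q -> cl P = cl Q ->
    forall u, sqn (u *m (P - Q)) <= e2 * sqn u.
Proof.
move=> e20; pose e := Num.min 1 (e2 / (N * N * N).+1%:R).
have e0 : 0 < e by rewrite lt_min ltr01 divr_gt0 // ltr0n.
pose L := (Num.truncn (2 / e)).+1.
pose cl (P : 'M[R]_N) : {ffun 'I_N * 'I_N -> 'I_L} :=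
  [ffun ij => inord (Num.truncn ((P ij.1 ij.2 + 1) / e))].
exists {ffun 'I_N * 'I_N -> 'I_L}, cl => P Q oP oQ clPQ u.
have PQ i j : `|(P - Q) i j| <= e.
  have := congr1 (fun f : {ffun _} => f (i, j)) clPQ; rewrite !ffunE /=.
  have hP := orthoproj_entry oP i j; have hQ := orthoproj_entry oQ i j.
  have rng (x : R) : `|x| <= 1 -> 0 <= (x + 1) / e /\
      (Num.truncn ((x + 1) / e) < L)%N.
    rewrite ler_norml => /andP[x1 x2]; have y0 : 0 <= (x + 1) / e.
      by apply: divr_ge0; lra.
    split=> //; rewrite ltnS; apply: le_truncn.
    by apply: ler_wpM2r; [rewrite invr_ge0; lra | lra].
  have [pP lP] := rng _ hP; have [pQ lQ] := rng _ hQ.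
  move/(congr1 (@nat_of_ord _)); rewrite !inordK // => eq.
  have := truncn_itv pP; have := truncn_itv pQ; rewrite eq.
  move=> /andP[q1 q2] /andP[p1 p2].
  rewrite !mxE -[leRHS]mul1r -ler_pdivrMr // -[X in _ / X]gtr0_norm // -normf_div.
  rewrite (_ : _ / e = (P i j + 1) / e - (Q i j + 1) / e); last by field; rewrite gt_eqF.
  by rewrite ler_norml; move: q1 q2 p1 p2; rewrite -!natr1; lra.
apply: le_trans (ler_norm _) _; rewrite -form_gram.
apply: le_trans (form_bound _ _) _; rewrite ler_wpM2r ?sqn_ge0 //.
have le i j : `|((P - Q) *m (P - Q)^T) i j| <= e *+ N.
  rewrite mxE (le_trans (ler_norm_sum _ _ _)) //.
  rewrite -[X in _ *+ X](card_ord N) -sumr_const; apply: ler_sum => k _.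
  rewrite normrM [X in _ * `|X|]mxE -[leRHS]mulr1 ler_pM //.
  by rewrite (le_trans (PQ j k)) // ge_min lexx.
apply: (@le_trans _ _ (\sum_(i < N) \sum_(j < N) e *+ N)).
  by do 2 (apply: ler_sum => ? _); exact: le.
rewrite !sumr_const !card_ord -!mulrnA mulnA -mulr_natr.
have : e <= e2 / (N * N * N).+1%:R by rewrite ge_min lexx orbT.
rewrite ler_pdivlMr ?ltr0n // => h; apply: le_trans h.
by rewrite ler_wpM2l ?ler_nat // ltW.
Qed.

End Subspaces.

(** * Transversality through resolvents *)

Section Resolvents.
Context (R : realType).

Lemma eqW (x y : R) : x = y -> x <= y.
Proof. by move->. Qed.

Lemma dot_le_mul N (u v : 'rV[R]_N) a b :
  0 <= a -> 0 <= b -> sqn u <= a ^+ 2 -> sqn v <= b ^+ 2 -> dot u v <= a * b.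
Proof.
move=> a0 b0 ua vb; have ab0 := mulr_ge0 a0 b0.
apply: le_trans (ler_norm _) _; rewrite -(@ler_pXn2r _ 2) ?nnegrE // exprMn.
rewrite real_normK ?num_real // (le_trans (dot_cauchy _ _)) // ler_pM //;
exact: sqn_ge0.
Qed.

Lemma sqn_triangle N (u v : 'rV[R]_N) a b : 0 <= a -> 0 <= b ->
  sqn u <= a ^+ 2 -> sqn v <= b ^+ 2 -> sqn (u + v) <= (a + b) ^+ 2.
Proof.
move=> a0 b0 ua vb; have := dot_le_mul a0 b0 ua vb.
by rewrite /sqn dotDl !dotDr (dotC v u) -!/(sqn _) !expr2 in ua vb *; nra.
Qed.

Definition resolvent M N (nu : R) (H : 'M[R]_(M, N)) : 'M[R]_N :=
  invmx (nu%:M + H^T *m H).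

Section Resolvent.
Variables (M N : nat) (nu : R) (H : 'M[R]_(M, N)).
Implicit Type v : 'rV[R]_N.
Hypothesis nu0 : 0 < nu.
Let A := nu%:M + H^T *m H.
Let Z := resolvent nu H.

Lemma shifted_gram_unit : A \in unitmx.
Proof.
apply: (coercive_unit nu0) => u; rewrite formDmx form_scalar lerDl.
by rewrite -{2}[H]trmxK form_gram sqn_ge0.
Qed.

Lemma resolvent_sym : Z^T = Z.
Proof.
by rewrite /Z /resolvent trmx_inv linearD /= tr_scalar_mx trmx_mul trmxK.
Qed.

Lemma resolvent_split v : v = nu *: (v *m Z) + v *m Z *m H^T *m H.
Proof.
have -> : nu *: (v *m Z) + v *m Z *m H^T *m H = v *m Z *m A.
  by rewrite mulmxDr mul_mx_scalar mulmxA.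
by rewrite mulmxKV // shifted_gram_unit.
Qed.

Lemma resolvent_form v : form Z v = nu * sqn (v *m Z) + sqn (v *m Z *m H^T).
Proof.
rewrite {1}/form {2}(resolvent_split v) dotDr dotZr; congr (_ + _).
by rewrite dotC dot_mull dotC.
Qed.

Lemma resolvent_ge0 v : 0 <= form Z v.
Proof. by rewrite resolvent_form addr_ge0 ?mulr_ge0 ?sqn_ge0 // ltW. Qed.

Lemma resolvent_le v : form Z v <= nu^-1 * sqn v.
Proof.
have nu_gt0 := nu0; have := dot_cauchy (v *m Z) v; rewrite -/(form Z v).
have : nu * sqn (v *m Z) <= form Z v by rewrite resolvent_form lerDl sqn_ge0.
have := resolvent_ge0 v; have := sqn_ge0 v; have := sqn_ge0 (v *m Z).
set f := form Z v; set y := sqn _; set x := sqn v => y0 x0 f0 yf ffyx.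
rewrite mulrC ler_pdivlMr //.
have [f_gt0|f_le0] := ltP 0 f; last by rewrite (_ : f = 0) ?mul0r; lra.
rewrite -(ler_pM2l f_gt0) mulrA -expr2.
have : nu * (f ^+ 2) <= nu * (y * x) by rewrite ler_pM2l.
nra.
Qed.

(** [1 - nu Z = X / (nu + X)] where [X] is the Gram matrix [H^T *m H]. *)
Definition coresolvent : 'M[R]_N := 1%:M - nu *: Z.

Lemma coresolvent_form v : form coresolvent v =
  nu * sqn (v *m Z *m H^T) + sqn (v *m Z *m H^T *m H).
Proof.
rewrite /coresolvent formDmx formNmx formZmx form_scalar mul1r.
rewrite resolvent_form {1}(resolvent_split v) /sqn !dotDl !dotDr !dotZl !dotZr.
rewrite [dot _ (_ *m H)]dotC [dot (_ *m H) (v *m Z)]dot_mull; ring.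
Qed.

Lemma coresolvent_mul v : v *m coresolvent = v *m Z *m H^T *m H.
Proof.
rewrite /coresolvent mulmxBr mulmx1 -scalemxAr {1}(resolvent_split v).
by rewrite addrC addKr.
Qed.

Lemma coresolvent_bound v : 0 <= form coresolvent v <= sqn v.
Proof.
apply/andP; split.
  by rewrite coresolvent_form addr_ge0 ?mulr_ge0 ?sqn_ge0 // ltW.
rewrite /coresolvent formDmx formNmx formZmx form_scalar mul1r gerBl.
by rewrite mulr_ge0 ?resolvent_ge0 // ltW.
Qed.

End Resolvent.

Definition absconvex N (Om : set 'rV[R]_N) : Prop :=
  forall u v s t, Om u -> Om v -> `|s| + `|t| <= 1 -> Om (s *: u + t *: v).

(** The two halves of transversality to a subspace, which is given by the
    orthogonal projection [P] onto it. *)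
Definition covers N (Om : set 'rV[R]_N) (r : R) (P : 'M[R]_N) : Prop :=
  forall b, sqn b <= 1 -> exists p,
    [/\ Om p, sqn p <= 1 & (b - r *: p) *m P = b - r *: p].

Definition bounded_on N (Om : set 'rV[R]_N) (r : R) (P : 'M[R]_N) : Prop :=
  forall p, Om p -> p *m P = p -> sqn p <= r ^+ 2.

Section TransverseForms.
Variables (M N : nat) (H : 'M[R]_(M, N)) (Om : set 'rV[R]_N) (P : 'M[R]_N).
Variables (r d : R).
Implicit Type v : 'rV[R]_N.
Hypotheses (cOm : absconvex Om) (oP : orthoproj P) (r1 : 1 <= r) (d1 : 1 <= d).
Hypothesis inner : forall c, sqn c <= 1 -> Om (c *m H).
Let r2_gt0 : 0 < r ^+ 2. Proof. exact: exprn_gt0 (lt_le_trans ltr01 r1). Qed.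
Let d2_gt0 : 0 < d ^+ 2. Proof. exact: exprn_gt0 (lt_le_trans ltr01 d1). Qed.
Hypothesis outer : forall p, Om p ->
  exists2 c, p = c *m H & sqn c <= 4 * d ^+ 2.

(** The form is the least [|c|^2 + 9 r^2 |u|^2] over the decompositions
    [v = c *m H + u]. Covering replaces [u] by a small multiple of a point of
    [Om], up to an element of the subspace; the sum is then in the subspace and,
    up to a factor, in [Om], where boundedness applies. *)
Lemma resolvent_lower v : covers Om r P -> bounded_on Om r P -> v *m P = v ->
  (4 * r ^+ 2)^-1 * sqn v <= form (resolvent (9 * r ^+ 2)^-1 H) v.
Proof.
have r_ge1 := r1; have r20 := r2_gt0.
move=> cov bd vP; pose nu := (9 * r ^+ 2)^-1.
have nu0 : 0 < nu by rewrite invr_gt0; lra.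
pose y := v *m resolvent nu H; pose c := y *m H^T.
have vE : v = nu *: y + c *m H by exact: resolvent_split.
have fE : form (resolvent nu H) v = nu * sqn y + sqn c by exact: resolvent_form.
rewrite -/nu; have f0 := resolvent_ge0 H nu0 v.
pose rho := Num.sqrt (form (resolvent nu H) v).
have rho2 : form (resolvent nu H) v = rho ^+ 2 by rewrite sqr_sqrtr.
have rho_ge0 : 0 <= rho by apply: sqrtr_ge0.
have y0 := sqn_ge0 y; have c0 := sqn_ge0 c.
rewrite mulrC ler_pdivrMr; last by lra.
have [rho0|rho_neq0] := eqVneq rho 0.
  have : nu * sqn y = 0 by move: fE; rewrite rho2 rho0; nra.
  move/eqP; rewrite mulf_eq0 gt_eqF //= => /eqP /sqn_eq0 yz.
  rewrite vE /c yz scaler0 add0r !mul0mx sqn0 mulr_ge0 //.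
    by rewrite -[X in form _ X]add0r; exact: resolvent_ge0.
  by nra.
have rho_gt0 : 0 < rho by rewrite lt_neqAle eq_sym rho_neq0.
have nuy : nu * sqn y <= rho ^+ 2 by rewrite -rho2 fE lerDl.
have sc : sqn c <= rho ^+ 2 by rewrite -rho2 fE lerDr mulr_ge0 // ltW.
have nuE : nu = (3 * r)^-1 ^+ 2 by rewrite /nu exprVn; congr (_^-1); ring.
have su : sqn (nu *: y) <= (rho / (3 * r)) ^+ 2.
  by rewrite sqnZ expr2 -mulrA exprMn -nuE mulrC ler_pM2r.
pose k := rho / (3 * r); have k0 : 0 < k by rewrite divr_gt0 //; lra.
have [p [Omp p1 pP]] : exists p, [/\ Om p, sqn p <= 1 &
    (k^-1 *: (nu *: y) - r *: p) *m P = k^-1 *: (nu *: y) - r *: p].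
  apply: cov; rewrite sqnZ exprVn mulrC ler_pdivrMr ?mul1r //.
  by rewrite exprn_gt0.
have {}pP : (nu *: y - (rho / 3) *: p) *m P = nu *: y - (rho / 3) *: p.
  have -> : nu *: y - (rho / 3) *: p = k *: (k^-1 *: (nu *: y) - r *: p).
    rewrite scalerBr !scalerA mulfV ?gt_eqF // mul1r; congr (_ - _ *: _).
    by rewrite /k; field; rewrite gt_eqF //; lra.
  by rewrite -scalemxAl pP.
(* [q] lies in the subspace and in [4 / 3 * rho] times [Om]. *)
pose q := c *m H + (rho / 3) *: p.
have qP : q *m P = q.
  have -> : q = v - (nu *: y - (rho / 3) *: p).
    by rewrite {1}vE /q; apply/rowP => i; rewrite !mxE; ring.
  by rewrite mulmxBl vP pP.
have Omq : Om ((4 / 3 * rho)^-1 *: q).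
  have -> : (4 / 3 * rho)^-1 *: q =
      (3 / 4) *: ((rho^-1 *: c) *m H) + (1 / 4) *: p.
    rewrite /q scalerDr -scalemxAl !scalerA; congr (_ *: _ + _ *: _);
    by field; rewrite gt_eqF.
  apply: cOm => //; last by rewrite !ger0_norm; lra.
  apply: inner; rewrite sqnZ exprVn mulrC ler_pdivrMr ?mul1r //.
  by rewrite exprn_gt0.
have sq : sqn q <= (4 / 3 * rho * r) ^+ 2.
  have := bd _ Omq; rewrite -scalemxAl qP => /(_ erefl).
  rewrite sqnZ exprVn mulrC ler_pdivrMr; last by rewrite exprn_gt0 //; lra.
  by move=> h; apply: le_trans h _; apply/eqW; ring.
have sp : sqn (- (rho / 3) *: p) <= (rho / 3) ^+ 2.
  by rewrite sqnZ sqrrN ler_piMr // sqr_ge0.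
have sv : sqn v <= (4 / 3 * rho * r + (rho / (3 * r) + rho / 3)) ^+ 2.
  have -> : v = q + (nu *: y + - (rho / 3) *: p).
    by rewrite {1}vE /q; apply/rowP => i; rewrite !mxE; ring.
  have rr : 0 <= rho / (3 * r) by apply: divr_ge0; lra.
  apply: sqn_triangle => //; [nra | lra |].
  by apply: sqn_triangle => //; lra.
apply: le_trans sv _; rewrite rho2 [leRHS](_ : _ = (2 * r * rho) ^+ 2); last by ring.
have k3 : rho / (3 * r) <= rho / 3 by rewrite ler_pM2l // lef_pV2 ?posrE; lra.
have rr : rho <= rho * r by rewrite ler_peMr.
by rewrite lerXn2r ?nnegrE //; rewrite -/k in k3 *; nra.
Qed.

(** The form is the square of the support function of the set of the points
    [c *m H] with [nu |c|^2 + |c *m H|^2 <= 1]. The point that covers the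
    direction of [v] is such a point, up to a factor, and its pairing with [v]
    is [|v| / r] because [v] is orthogonal to the subspace. *)
Lemma coresolvent_lower v : covers Om r P -> v *m P = 0 ->
  (2 * r ^+ 2)^-1 * sqn v <= form (coresolvent (4 * d ^+ 2)^-1 H) v.
Proof.
have r20 := r2_gt0; have d20 := d2_gt0.
move=> cov vP; pose nu := (4 * d ^+ 2)^-1.
have nu0 : 0 < nu by rewrite invr_gt0; lra.
rewrite -/nu; have /andP[f0 _] := coresolvent_bound H nu0 v.
rewrite mulrC ler_pdivrMr; last by lra.
have [v0|] := eqVneq (sqn v) 0; first by rewrite v0 mulr_ge0 //; nra.
have v_ge0 := sqn_ge0 v => v_neq0.
pose n := Num.sqrt (sqn v); have nE : sqn v = n ^+ 2 by rewrite sqr_sqrtr.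
have n0 : 0 < n by rewrite sqrtr_gt0 lt_neqAle eq_sym v_neq0.
have [p [/outer[c -> sc] sp pP]] : exists p, [/\ Om p, sqn p <= 1 &
    (n^-1 *: v - r *: p) *m P = n^-1 *: v - r *: p].
  apply: cov; rewrite sqnZ exprVn mulrC ler_pdivrMr ?mul1r ?nE //.
  by rewrite exprn_gt0.
have nrp : n = r * dot (c *m H) v.
  have [symP _] := oP.
  have : dot (n^-1 *: v - r *: (c *m H)) v = 0.
    by rewrite -pP dot_mull symP vP dotC /dot mul0mx mxE.
  rewrite dotDl dotNl !dotZl -/(sqn v) nE expr2 mulKf ?gt_eqF //.
  by move/eqP; rewrite subr_eq0 => /eqP.
rewrite coresolvent_form //.
pose z := v *m resolvent nu H; rewrite -/z.
have vE : v = nu *: z + z *m H^T *m H by exact: resolvent_split.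
have dE : dot (c *m H) v = nu * dot c (z *m H^T) + dot (c *m H) (z *m H^T *m H).
  by rewrite {1}vE dotDr dotZr -dot_mull.
have := dot_cauchy c (z *m H^T); have := dot_cauchy (c *m H) (z *m H^T *m H).
move: nrp dE; rewrite nE; set D := dot _ v; set D1 := dot c _.
set D2 := dot _ (_ *m H); have := sqn_ge0 (z *m H^T); have := sqn_ge0 (z *m H^T *m H).
move: sc sp; set x := sqn c; set y := sqn (c *m H).
set g1 := sqn (_ *m H^T); set g2 := sqn _ => sc sp g20 g10 -> -> h2 h1.
have nux : nu * x <= 1 by rewrite mulrC ler_pdivrMr ?mul1r //; nra.
have k1 : (nu * D1) ^+ 2 <= nu * g1.
  have e1 : nu ^+ 2 * D1 ^+ 2 <= nu ^+ 2 * (x * g1) by rewrite ler_pM2l ?exprn_gt0.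
  rewrite exprMn (le_trans e1) // (_ : _ * _ = nu * g1 * (nu * x)); last by ring.
  by rewrite ler_piMr // mulr_ge0 // ltW.
have k2 : D2 ^+ 2 <= g2 by apply: le_trans h2 _; rewrite ler_piMl.
rewrite exprMn mulrC mulrCA [leRHS]mulrC -mulrA.
have : (nu * D1 + D2) ^+ 2 <= 2 * (nu * g1 + g2).
  have := sqr_ge0 (nu * D1 - D2); rewrite !expr2 in k1 k2 *; nra.
by move=> h; rewrite -mulrA (mulrC (_ ^+ 2)) mulrA; nra.
Qed.

(** On the points [c *m H] the form is at most [|c|^2]. *)
Lemma resolvent_upper nu : 0 < nu -> ~ bounded_on Om (256 * d * r) P ->
  exists2 v, v *m P = v &
    form (resolvent nu H) v < ((128 * r) ^+ 2)^-1 * sqn v.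
Proof.
have r_ge1 := r1.
move=> nu0 nbd; apply: contrapT => h; apply: nbd => v Omv vP.
rewrite leNgt; apply/negP => big; apply: h; exists v => //.
have [c vE sc] := outer Omv.
have fc : form (resolvent nu H) v <= sqn c.
  have := dot_cauchy c (v *m resolvent nu H *m H^T).
  rewrite -dot_mull -vE dotC -/(form _ v).
  have := resolvent_ge0 H nu0 v; have := sqn_ge0 c.
  have : sqn (v *m resolvent nu H *m H^T) <= form (resolvent nu H) v.
    by rewrite resolvent_form // lerDr mulr_ge0 ?sqn_ge0 // ltW.
  set f := form _ _; set g := sqn (_ *m _); set x := sqn c => gf x0 f0 ffxg.
  have [f_gt0|] := ltP 0 f; last by lra.
  by rewrite -(ler_pM2r f_gt0) -expr2 (le_trans ffxg) // ler_wpM2l.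
rewrite mulrC ltr_pdivlMr; last by rewrite exprn_gt0 //; lra.
apply: le_lt_trans big; apply: le_trans (_ : 4 * d ^+ 2 * (128 * r) ^+ 2 <= _).
  by rewrite ler_wpM2r ?sqr_ge0 // (le_trans fc).
by rewrite !exprMn; apply/eqW; ring.
Qed.

(** Where the form is bounded below its compression to the complement is
    invertible. A preimage [x] of [b] gives the point [x *m Y], which is equal to
    [b] modulo the subspace and whose size is controlled by the form at [x]. *)
Lemma coresolvent_upper : ~ covers Om (256 * d * r) P ->
  exists2 v, v *m P = 0 &
    form (coresolvent (4 * d ^+ 2)^-1 H) v < ((128 * r) ^+ 2)^-1 * sqn v.
Proof.
have r_ge1 := r1; have d_ge1 := d1; have r20 := r2_gt0; have d20 := d2_gt0.
move=> ncov; apply: contrapT => h; apply: ncov => b b1.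
pose nu := (4 * d ^+ 2)^-1; pose Y := coresolvent nu H.
have nu0 : 0 < nu by rewrite invr_gt0; lra.
pose be := ((128 * r) ^+ 2)^-1.
have r2 : 1 <= (128 * r) ^+ 2 by rewrite expr_ge1 //; lra.
have be0 : 0 < be by rewrite invr_gt0 (lt_le_trans ltr01).
have be1 : be <= 1 by rewrite invf_le1 // (lt_le_trans ltr01).
have low v : v *m P = 0 -> be * sqn v <= form Y v.
  by move=> vP; rewrite leNgt; apply/negP => fv; apply: h; exists v.
have [symP PP] := oP; have oQ := orthoproj_compl oP; have [symQ QQ] := oQ.
set Q := 1%:M - P in oQ symQ QQ.
have QP : Q *m P = 0 by rewrite /Q mulmxBl mul1mx PP subrr.
(* the compression of [Y], completed by the identity on the subspace *)
pose K := Q *m Y *m Q + P.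
have uK : K \in unitmx.
  apply: (coercive_unit be0) => u; rewrite formDmx -{2}symQ form_conj.
  rewrite -[X in form X u]PP -{2}symP form_gram (orthoproj_pythagoras oP u) -/Q.
  have := low (u *m Q); rewrite -mulmxA QP mulmx0 => /(_ erefl).
  by have := sqn_ge0 (u *m P); nra.
pose x := b *m Q *m invmx K.
have xK : x *m K = b *m Q by rewrite /x mulmxKV.
have KP : K *m P = P by rewrite /K mulmxDl -!mulmxA QP !mulmx0 add0r.
have xP : x *m P = 0 by rewrite -KP mulmxA xK -mulmxA QP mulmx0.
have xQ : x *m Q = x by rewrite /Q mulmxBr mulmx1 xP subr0.
have xYQ : x *m Y *m Q = b *m Q.
  by rewrite -xK /K [RHS]mulmxDr xP addr0 !mulmxA xQ.
have fx : form Y x = dot b x.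
  by rewrite /form -{2}xQ -[in LHS]symQ -dot_mull xYQ dot_mull symQ xQ.
have fle : form Y x <= (128 * r) ^+ 2.
  have := dot_cauchy b x; rewrite -fx; have := low x xP; have := sqn_ge0 x.
  rewrite mulrC ler_pdivrMr ?(lt_le_trans ltr01) //.
  have : 0 <= form Y x by case/andP: (coresolvent_bound H nu0 x).
  have := sqn_ge0 b; set f := form _ _; set s := sqn x; set t := sqn b.
  move=> t0 f0 s0 sf ff.
  have [f_gt0|f_le0] := ltP 0 f; last by apply: le_trans f_le0 _; lra.
  rewrite -(ler_pM2l f_gt0) -expr2; apply: le_trans ff (le_trans _ sf).
  by rewrite ler_piMl.
pose c := x *m resolvent nu H *m H^T.
have xY : x *m Y = c *m H by exact: coresolvent_mul.
have fE : form Y x = nu * sqn c + sqn (c *m H) by exact: coresolvent_form.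
have sc0 := sqn_ge0 c; have scH0 := sqn_ge0 (c *m H).
pose k := 256 * d * r; have k0 : 0 < k by rewrite /k; nra.
exists (k^-1 *: (c *m H)); split.
- rewrite scalemxAl; apply: inner.
  rewrite sqnZ exprVn mulrC ler_pdivrMr ?exprn_gt0 // mul1r.
  have : nu * sqn c <= (128 * r) ^+ 2 by apply: le_trans fle; rewrite fE lerDl.
  rewrite mulrC ler_pdivrMr; last by lra.
  by move=> hc; apply: le_trans hc _; apply/eqW; rewrite /k; ring.
- rewrite sqnZ exprVn mulrC ler_pdivrMr ?exprn_gt0 // mul1r.
  apply: (@le_trans _ _ ((128 * r) ^+ 2)).
    by apply: le_trans fle; rewrite fE lerDr mulr_ge0 // ltW.
  by rewrite lerXn2r ?nnegrE // /k; nra.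
- rewrite scalerA mulfV ?gt_eqF // scale1r.
  have : (b - c *m H) *m Q = 0 by rewrite mulmxBl -xY xYQ subrr.
  by rewrite {1}/Q mulmxBr mulmx1 => /eqP; rewrite subr_eq0 => /eqP <-.
Qed.

End TransverseForms.

End Resolvents.

(** * Ellipsoids comparable to absolutely convex sets *)

Section Ellipsoids.
Context (R : realType).

(** The total weight is kept as a factor, so that binary combinations suffice for
    the induction. *)
Lemma absconvex_comb N (Om : set 'rV[R]_N) (I : Type) (s : seq I)
    (c : I -> R) (v : I -> 'rV[R]_N) :
  absconvex Om -> Om 0 -> (forall i, Om (v i)) ->
  exists2 u, Om u & \sum_(i <- s) c i *: v i = (\sum_(i <- s) `|c i|) *: u.
Proof.
move=> cOm Om0 Omv; elim: s => [|i s [u Omu IH]].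
  by exists 0 => //; rewrite !big_nil scaler0.
rewrite !big_cons IH; set S := \sum_(j <- s) _; pose t := `|c i| + S.
have S0 : 0 <= S by apply: sumr_ge0.
have c0 := normr_ge0 (c i); rewrite -/t.
have [t0|t_neq0] := eqVneq t 0.
  exists 0 => //; rewrite (_ : S = 0) ?scale0r ?addr0 ?scaler0; last first.
    by rewrite /t in t0; lra.
  have : `|c i| = 0 by rewrite /t in t0; lra.
  by move/normr0_eq0 ->; rewrite scale0r.
have t_gt0 : 0 < t by rewrite lt_neqAle eq_sym t_neq0 /t; lra.
exists ((t^-1 * c i) *: v i + (t^-1 * S) *: u).
  apply: cOm => //; rewrite !normrM (ger0_norm S0) -mulrDr -/t.
  by rewrite normfV gtr0_norm // mulVf.
by rewrite scalerDr !scalerA !mulrA mulfV // !mul1r.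
Qed.

Lemma norm_det_le N (A : 'M[R]_N) (C : R) :
  (forall i j, `|A i j| <= C) -> `|\det A| <= \sum_(g : 'S_N) C ^+ N.
Proof.
move=> AC; apply: le_trans (ler_norm_sum _ _ _) _; apply: ler_sum => g _.
rewrite normrM normr_sign mul1r normr_prod -[X in C ^+ X](card_ord N) -prodr_const.
by apply: ler_prod => i _; rewrite normr_ge0 /=.
Qed.

(** Cramer's rule. *)
Lemma det_replace_row N (W : 'M[R]_N) (c : 'rV[R]_N) i :
  \det (\matrix_(k, j) if k == i then (c *m W) 0 j else W k j) = c 0 i * \det W.
Proof.
rewrite (expand_det_row _ i).
have -> : c 0 i * \det W = (c *m W *m \adj W) 0 i.
  by rewrite -mulmxA mul_mx_adj mul_mx_scalar mxE mulrC.
rewrite [RHS]mxE; apply: eq_bigr => j _; rewrite mxE eqxx; congr (_ * _).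
rewrite [RHS]mxE /cofactor; congr (_ * \det _); apply/matrixP => k l.
by rewrite !mxE eq_sym (negbTE (neq_lift _ _)).
Qed.

(** The rows of [G] maximize, up to a factor two, the volume that vectors of [Om]
    span, among families of maximal rank: by Cramer's rule the coordinates of a
    point of [Om] are then at most two. Comparing the cube and the cross-polytope
    with balls loses a factor [Num.sqrt M] twice. *)
Lemma ellipsoid_exists N (Om : set 'rV[R]_N) (B : R) :
  absconvex Om -> Om 0 -> (forall p, Om p -> sqn p <= B) ->
  exists M, exists2 G : 'M[R]_(M, N), (M <= N)%N &
    (forall c, sqn c <= 1 -> Om (c *m G)) /\
    (forall p, Om p -> exists2 c, p = c *m G & sqn c <= 4 * M%:R ^+ 2).
Proof.
move=> cOm Om0 bOm.
pose fam k (G : 'M[R]_(k, N)) := forall i, Om (row i G).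
pose free k := `[< exists2 G : 'M[R]_(k, N), row_free G & fam k G >].
have ex_free : exists k, free k.
  exists 0; apply/asboolP; exists 0 => [|[]//].
  by rewrite /row_free mxrank0.
have le_free k : free k -> (k <= N)%N.
  by move=> /asboolP[G /eqP fG _]; rewrite -fG rank_leq_col.
case: (ex_maxnP ex_free le_free) => M /asboolP[G0 fG0 OmG0] maxM.
(* volumes are determinants in the coordinates given by [G0] *)
pose L := pinvmx G0; have G0L : G0 *m L = 1%:M by exact: mulmxVp.
pose S := [set `|\det (G *m L)| | G in fam M].
have B0 : 0 <= B by have := bOm 0 Om0; rewrite sqn0.
have S1 : S 1 by exists G0 => //; rewrite G0L det1 normr1.
have [C C0 LC] : exists2 C, 0 <= C & forall j, sqn (col j L)^T <= C.
  exists (\sum_j sqn (col j L)^T); first by apply: sumr_ge0 => j _; exact: sqn_ge0.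
  by move=> j; rewrite (bigD1 j) //= lerDl; apply: sumr_ge0 => ? _; exact: sqn_ge0.
have supS : has_sup S.
  split; first by exists 1.
  exists (\sum_(g : 'S_M) (B * C + 1) ^+ M) => _ [G OmG <-].
  apply: norm_det_le => i j.
  have -> : (G *m L) i j = dot (row i G) (col j L)^T.
    by rewrite /dot trmxK !mxE; apply: eq_bigr => k _; rewrite !mxE.
  set x := dot _ _; have := dot_cauchy (row i G) (col j L)^T; rewrite -/x => xx.
  have : x ^+ 2 <= B * C by apply: le_trans xx _; apply: ler_pM; rewrite ?sqn_ge0 // ?bOm.
  by rewrite -(real_normK (num_real x)); have := normr_ge0 x; nra.
have sup1 : 1 <= sup S by exact: sup_upper_bound.
have [_ [G OmG <-] big] : exists2 y, S y & sup S / 2 < y.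
  by have [] := @sup_gt R S (sup S / 2) (ex_intro _ _ S1); [lra | move=> y; exists y].
pose W := G *m L; rewrite -/W in big.
have detW : 0 < `|\det W| by lra.
have fG : row_free G.
  apply/row_freeP; exists (L *m invmx W); rewrite mulmxA mulmxV //.
  by rewrite unitmxE unitfE -normr_gt0.
have coords p : Om p -> exists2 c, p = c *m G & forall i, `|c 0 i| <= 2.
  move=> Omp; have /submxP[c pE] : (p <= G)%MS.
    apply: contrapT => /negP npG; suff : (M + 1 <= M)%N by rewrite addn1 ltnn.
    apply: maxM; apply/asboolP; exists (col_mx G p); last first.
      move=> i; rewrite -(fintype.splitK i); case: (fintype.split i) => k /=.
        by rewrite rowKu; exact: OmG.
      by rewrite rowKd (_ : row k p = p) //; apply/rowP => j; rewrite mxE ord1.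
    have GGp : (G < col_mx G p)%MS.
      apply/andP; split; first by rewrite -addsmxE addsmxSl.
      by rewrite -addsmxE addsmx_sub (negbTE npG) andbF.
    have := rank_ltmx GGp; rewrite (eqP fG) => rk.
    by rewrite /row_free eqn_leq rank_leq_row; apply: leq_trans rk; rewrite addn1.
  exists c => // i.
  pose G' := \matrix_(k, j) if k == i then p 0 j else G k j.
  have OmG' : fam M G'.
    move=> k; have [->|ki] := eqVneq k i.
      by rewrite (_ : row i G' = p) //; apply/rowP => j; rewrite !mxE eqxx.
    rewrite (_ : row k G' = row k G) //.
    by apply/rowP => j; rewrite !mxE (negbTE ki).
  have G'L : G' *m L = \matrix_(k, j) if k == i then (c *m W) 0 j else W k j.
    apply/matrixP => k j; rewrite [RHS]mxE; case: ifP => ki.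
      rewrite (_ : c *m W = p *m L); last by rewrite /W mulmxA -pE.
      by rewrite !mxE; apply: eq_bigr => l _; rewrite !mxE ki.
    by rewrite !mxE; apply: eq_bigr => l _; rewrite !mxE ki.
  have : `|\det (G' *m L)| <= sup S by apply: sup_upper_bound => //; exists G'.
  rewrite G'L det_replace_row normrM => h.
  rewrite -(ler_pM2r detW); lra.
exists M, ((Num.sqrt M%:R)^-1 *: G); first by apply: le_free; apply/asboolP; exists G.
pose q := Num.sqrt (M%:R : R); have q0 : 0 <= q by exact: sqrtr_ge0.
have q2 : q ^+ 2 = M%:R by rewrite sqr_sqrtr.
rewrite -/q; split=> [c c1|p Omp].
  rewrite -scalemxAr mulmx_sum_row.
  have [u Omu ->] := @absconvex_comb N Om _ (index_enum 'I_M) (fun i => c 0 i)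
    (fun i => row i G) cOm Om0 OmG.
  rewrite scalerA -[_ *: u]addr0 -(scale0r u); apply: cOm => //.
  rewrite normr0 addr0; set s := \sum_(i <- _) _.
  have s2 : s ^+ 2 <= M%:R.
    pose a : 'rV[R]_M := \row_i `|c 0 i|; pose one : 'rV[R]_M := const_mx 1.
    have -> : s = dot a one.
      by rewrite dotE; apply: eq_bigr => i _; rewrite !mxE mulr1.
    have ac : sqn a = sqn c.
      rewrite /sqn !dotE; apply: eq_bigr => i _.
      by rewrite !mxE -!expr2 real_normK ?num_real.
    have oneM : sqn one = M%:R.
      rewrite /sqn dotE; under eq_bigr => i _ do rewrite !mxE mulr1.
      by rewrite sumr_const card_ord.
    by apply: le_trans (dot_cauchy _ _) _; rewrite ac oneM ler_piMl // ler0n.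
  have s0 : 0 <= s by apply: sumr_ge0.
  rewrite normrM (ger0_norm s0) ger0_norm ?invr_ge0 //.
  have [q_0|q_neq0] := eqVneq q 0; first by rewrite q_0 invr0 mul0r.
  have q_gt0 : 0 < q by rewrite lt_neqAle eq_sym q_neq0.
  rewrite mulrC ler_pdivrMr // mul1r -(@ler_pXn2r _ 2) ?nnegrE //.
  by rewrite q2.
have [c pE c2] := coords p Omp; exists (q *: c).
  have [M0|M_gt0] := posnP M.
    have G0' : G = 0 by apply/matrixP => i; have := ltn_ord i; rewrite {2}M0.
    by rewrite pE G0' scaler0 !mulmx0.
  rewrite -scalemxAl -scalemxAr scalerA mulfV ?scale1r //.
  by rewrite sqrtr_eq0 -ltNge ltr0n.
rewrite sqnZ q2 /sqn dotE; apply: (@le_trans _ _ (M%:R * \sum_(i < M) 4)).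
  rewrite ler_wpM2l // ler_sum // => i _; rewrite -expr2.
  by rewrite -(real_normK (num_real (c 0 i))); have := c2 i; have := normr_ge0 (c 0 i); nra.
by rewrite sumr_const card_ord -[4 *+ _]mulr_natr expr2 mulrCA.
Qed.

End Ellipsoids.

(** * Chains for a one-parameter group of dilations *)

Section Chains.
Context (R : realType).
Variables (N : nat) (w : 'I_N -> nat) (m : nat).
Hypothesis w_le : forall i, (w i <= m)%N.

Definition dil (t : R) : 'M[R]_N := diag_mx (\row_i t ^+ w i).

(** Cramer's rule makes the resolvent a quotient of polynomials in [t]; the
    common denominator is squared to be positive. *)
Lemma resolvent_poly M (G : 'M[R]_(M, N)) nu : 0 < nu ->
  exists (A : 'M[{poly R}]_N) (p : {poly R}),
  [/\ A^T = A, forall i j, (size (A i j) <= (N * (m + m) + N * (m + m)).+1)%N,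
      (size p <= (N * (m + m) + N * (m + m)).+1)%N
    & forall t, 0 < p.[t] /\ evmx A t = p.[t] *: resolvent nu (G *m dil t)].
Proof.
move=> nu0.
pose T : 'M[{poly R}]_N := diag_mx (\row_i 'X^(w i)).
pose K := (nu%:P)%:M + T *m map_mx polyC (G^T *m G) *m T.
have symT : T^T = T by exact: tr_diag_mx.
have symK : K^T = K.
  by rewrite /K linearD /= tr_scalar_mx !trmx_mul symT map_trmx trmx_mul trmxK mulmxA.
have evT t : evmx T t = dil t.
  apply/matrixP => i j; rewrite !mxE /horner_eval hornerMn.
  by rewrite hornerXn.
have evK t : evmx K t = nu%:M + (G *m dil t)^T *m (G *m dil t).
  rewrite /K evmxD !evmxM evmx_const !evT; congr (_ + _).
    by apply/matrixP => i j; rewrite !mxE /horner_eval hornerMn hornerC.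
  by rewrite trmx_mul tr_diag_mx !mulmxA.
have sT i j : (size (T i j) <= m.+1)%N.
  rewrite !mxE; case: (i == j); rewrite ?mulr1n ?mulr0n ?size_poly0 //.
  by rewrite size_polyXn ltnS.
have sC (C : 'M[R]_N) k l : (size (map_mx polyC C k l) <= 1)%N.
  by rewrite mxE size_polyC; case: (_ != 0).
have sK i j : (size (K i j) <= (m + m).+1)%N.
  rewrite mxE (leq_trans (size_polyD _ _)) // geq_max; apply/andP; split.
    rewrite mxE; case: (i == j); rewrite ?mulr1n ?mulr0n ?size_poly0 //.
    by rewrite size_polyC; case: (_ != 0).
  by have := size_mulmx (size_mulmx sT (sC _)) sT i j; rewrite addn0; apply.
exists (\det K *: \adj K), (\det K ^+ 2); split.
- by rewrite linearZ /= trmx_adj symK.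
- by move=> i j; rewrite mxE; apply: size_mul_leS; [exact: size_det | exact: size_adj].
- by rewrite expr2; apply: size_mul_leS; exact: size_det.
move=> t; have uK : evmx K t \in unitmx by rewrite evK; exact: shifted_gram_unit.
have dK : (\det K).[t] != 0 by rewrite -det_evmx -unitfE -unitmxE.
split; first by rewrite horner_exp exprn_even_gt0.
rewrite evmxZ horner_exp /resolvent -evK /evmx map_mx_adj -/(evmx K t).
by rewrite [in RHS]/invmx uK scalerA det_evmx expr2 mulfK.
Qed.

Definition transverse_to (Om : set 'rV[R]_N) (r : R) (P : 'M[R]_N) : Prop :=
  covers Om r P /\ bounded_on Om r P.

Definition dilate (t : R) (Om : set 'rV[R]_N) : set 'rV[R]_N :=
  [set p *m dil t | p in Om].

Lemma absconvex_dilate t Om : absconvex Om -> absconvex (dilate t Om).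
Proof.
move=> cOm _ _ a b [u Omu <-] [v Omv <-] ab.
exists (a *: u + b *: v); first exact: cOm.
by rewrite mulmxDl -!scalemxAl.
Qed.

(** A failure of transversality is either a failure of covering, seen by the
    coresolvent on the orthogonal complement, or a failure of boundedness, seen
    by the resolvent; each alternates boundedly often within each class of
    nearby subspaces. *)
Lemma bounded_chain_bound (d r : R) : 1 <= d -> N%:R <= d -> 1 <= r ->
  exists K0, forall (Om : set 'rV[R]_N) (B : R) (K : nat) (t0 t1 : 'I_K -> R)
      (P : 'I_K -> 'M[R]_N),
    absconvex Om -> (forall p, Om p -> sqn p <= B) ->
    (forall k, orthoproj (P k)) -> (forall k, 0 < t0 k <= t1 k) ->
    (forall j k, j != k -> t1 j <= t0 k \/ t1 k <= t0 j) ->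
    (forall k, transverse_to (dilate (t0 k) Om) r (P k)) ->
    (forall k, ~ transverse_to (dilate (t1 k) Om) (256 * d * r) (P k)) ->
    (K <= K0)%N.
Proof.
move=> d1 Nd r1.
have r2 : 1 <= r ^+ 2 by rewrite expr_ge1 //; lra.
have d2 : 1 <= d ^+ 2 by rewrite expr_ge1 //; lra.
(* the threshold for failure; those for success are at least [4096 * b] *)
pose b := ((128 * r) ^+ 2)^-1 : R.
have bE : b = (128 ^+ 2)^-1 * (r ^+ 2)^-1 by rewrite /b exprMn invfM.
have ir2 : 0 < (r ^+ 2)^-1 by rewrite invr_gt0; lra.
have ir2' : r ^+ 2 * (r ^+ 2)^-1 = 1 by rewrite mulfV //; apply: lt0r_neq0; lra.
have b0 : 0 < b by rewrite bE mulr_gt0 // invr_gt0 exprn_gt0.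
pose e2 := Num.min (1 / 8) (b / 2 / (9 * r ^+ 2)).
have e20 : 0 < e2 by rewrite lt_min !divr_gt0 //; lra.
have e28 : 0 <= e2 <= 1 / 8 by rewrite ltW //= ge_min lexx.
have e2b : 9 * r ^+ 2 * e2 <= b / 2.
  rewrite mulrC -ler_pdivlMr; last by lra.
  by rewrite ge_min lexx orbT.
have [C [cl clP]] := @orthoproj_classes R N e2 e20.
pose s := (N * (m + m) + N * (m + m))%N.
exists (#|{: bool * C}| * (N * s))%N => Om B K t0 t1 P cOm bOm oP t01 disj sat fail.
have [->|K_gt0] := posnP K; first by [].
have Om0 : Om 0.
  have [[cov _] _] := (sat (Ordinal K_gt0), tt).
  have [|p [[q Omq _] _ _]] := cov 0; first by rewrite sqn0.
  by rewrite -(addr0 0) -(scale0r q); apply: cOm => //; rewrite normr0 addr0.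
have [M [G MN [inner outer]]] := ellipsoid_exists cOm Om0 bOm.
have inn t c : sqn c <= 1 -> dilate t Om (c *m (G *m dil t)).
  by move=> c1; exists (c *m G); [exact: inner | rewrite mulmxA].
have out t p : dilate t Om p -> exists2 c, p = c *m (G *m dil t) & sqn c <= 4 * d ^+ 2.
  move=> [q /outer[c -> sc] <-]; exists c; first by rewrite mulmxA.
  apply: le_trans sc _; rewrite ler_pM2l // lerXn2r ?nnegrE //; first by lra.
  by apply: le_trans Nd; rewrite ler_nat.
pose badcov k := `[< ~ covers (dilate (t1 k) Om) (256 * d * r) (P k) >].
pose col k := (badcov k, cl (P k)).
pose J x := [set k | col k == x]%SET.
suff cJ x : (#|J x| <= N * s)%N.
  rewrite -[X in (X <= _)%N]card_ord -sum1_card (partition_big col predT) //=.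
  rewrite -sum_nat_const; apply: leq_sum => x _; apply: leq_trans (cJ x).
  by rewrite sum1dep_card.
have nearby y j k : j \in J y -> k \in J y ->
    forall u, sqn (u *m (P j - P k)) <= e2 * sqn u.
  rewrite !inE => /eqP jy /eqP ky; apply: clP => //.
  by move: jy; rewrite -ky => -[].
case: x => [[] c].
- pose nu := (4 * d ^+ 2)^-1; have nu0 : 0 < nu by rewrite invr_gt0; lra.
  have [A [p [symA sA sp evA]]] := resolvent_poly G nu0.
  pose Y := p%:M - nu%:P *: A.
  have evY t : evmx Y t = p.[t] *: coresolvent nu (G *m dil t).
    have [_ eA] := evA t; rewrite /Y -scaleN1r evmxD !evmxZ eA /coresolvent.
    rewrite scalerBr !scalerA hornerN !hornerC mulN1r mulrC -scaleNr; congr (_ + _);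
      last by rewrite mulrN.
    by apply/matrixP => i j; rewrite !mxE /horner_eval hornerMn mulr_natr.
  apply: (@alternation_count_close R N Y p s 1 (2 * r ^+ 2)^-1 b e2 _ _ t0 t1
    (fun k => 1%:M - P k)) => //.
  + by rewrite /Y linearB linearZ /= tr_scalar_mx symA.
  + move=> i j; rewrite mxE (leq_trans (size_polyD _ _)) // geq_max.
    apply/andP; split.
      by rewrite mxE; case: (i == j); rewrite ?mulr1n ?mulr0n ?size_poly0.
    by rewrite mxE size_polyN mxE mul_polyC (leq_trans (size_scale_leq _ _)).
  + by move=> t _; have [] := evA t.
  + move=> t _ u; have [pt _] := evA t; rewrite evY formZmx mul1r.
    have /andP[f0 f1] := coresolvent_bound (G *m dil t) nu0 u.
    by apply/andP; split; [apply: mulr_ge0 => //; exact: ltW | rewrite ler_pM2l].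
  + by rewrite bE invfM; lra.
  + by rewrite mul1r; apply: le_trans e2b; rewrite ler_peMl //; lra.
  + by move=> k; exact: orthoproj_compl.
  + move=> j k jJ kJ u.
    rewrite (_ : 1%:M - P j - (1%:M - P k) = P k - P j); first exact: nearby kJ jJ u.
    by rewrite opprB addrC addrA subrK.
  + move=> k _ u uP; have [pt _] := evA (t0 k); rewrite evY formZmx.
    rewrite (mulrC _ p.[_]) -mulrA ler_pM2l //.
    apply: (coresolvent_lower (oP k) r1 d1 (@out _) (sat k).1 _) => //.
    by move: uP; rewrite mulmxBr mulmx1 => /eqP; rewrite subr_eq addrC -subr_eq subrr
      => /eqP.
  + move=> k; rewrite inE => /eqP[/asboolP ncov _].
    have [u uP fu] := coresolvent_upper (oP k) r1 d1 (inn _) ncov.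
    exists u; first by rewrite mulmxBr mulmx1 uP subr0.
    have [pt _] := evA (t1 k); rewrite evY formZmx.
    by rewrite (mulrC _ p.[_]) -mulrA ltr_pM2l.
- pose nu := (9 * r ^+ 2)^-1; have nu0 : 0 < nu by rewrite invr_gt0; lra.
  have [A [p [symA sA sp evA]]] := resolvent_poly G nu0.
  apply: (@alternation_count_close R N A p s nu^-1 (4 * r ^+ 2)^-1 b e2 _ _ t0 t1 P)
    => //.
  + by move=> t _; have [] := evA t.
  + move=> t _ u; have [pt ->] := evA t; rewrite formZmx.
    apply/andP; split; first by apply: mulr_ge0; [exact: ltW | exact: resolvent_ge0].
    by rewrite (mulrC _ p.[t]) -mulrA ler_pM2l // resolvent_le.
  + by rewrite invr_ge0 ltW.
  + by rewrite bE invfM; lra.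
  + by rewrite /nu invrK.
  + exact: nearby.
  + move=> k _ u uP; have [pt ->] := evA (t0 k); rewrite formZmx.
    rewrite (mulrC _ p.[_]) -mulrA ler_pM2l //; have [cov bd] := sat k.
    exact: (resolvent_lower (@absconvex_dilate _ _ cOm) r1 (inn _) cov bd uP).
  + move=> k; rewrite inE => /eqP[/asboolPn ncov _].
    have nbd : ~ bounded_on (dilate (t1 k) Om) (256 * d * r) (P k).
      move=> bd; apply: (fail k); split=> //; exact: contrapT.
    have [u uP fu] := resolvent_upper r1 (@out _) nu0 nbd.
    exists u => //; have [pt ->] := evA (t1 k); rewrite formZmx.
    by rewrite (mulrC _ p.[_]) -mulrA ltr_pM2l.
Qed.

Lemma dilVK t : t != 0 -> dil t *m dil t^-1 = 1%:M.
Proof.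
move=> t0; rewrite /dil mulmx_diag -diag_const_mx; congr diag_mx.
by apply/rowP => i; rewrite !mxE exprVn mulfV // expf_neq0.
Qed.

(** Intersecting [Om] with a large ball preserves a chain: every covering uses points
    of norm at most one, and a point violating boundedness can be shrunk until it
    only just violates it. *)
Lemma chain_bound (d r : R) : 1 <= d -> N%:R <= d -> 1 <= r ->
  exists K0, forall (Om : set 'rV[R]_N) (K : nat) (t0 t1 : 'I_K -> R)
      (P : 'I_K -> 'M[R]_N),
    absconvex Om ->
    (forall k, orthoproj (P k)) -> (forall k, 0 < t0 k <= t1 k) ->
    (forall j k, j != k -> t1 j <= t0 k \/ t1 k <= t0 j) ->
    (forall k, transverse_to (dilate (t0 k) Om) r (P k)) ->
    (forall k, ~ transverse_to (dilate (t1 k) Om) (256 * d * r) (P k)) ->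
    (K <= K0)%N.
Proof.
move=> d1 Nd r1; have [K0 HK0] := bounded_chain_bound d1 Nd r1.
exists K0 => Om K t0 t1 P cOm oP t01 disj sat fail.
pose rho := 256 * d * r; have rho0 : 0 < rho by rewrite /rho; nra.
pose c t : R := \sum_i \sum_j `|(dil t^-1 *m (dil t^-1)^T) i j|.
have c0 t : 0 <= c t by apply: sumr_ge0 => i _; apply: sumr_ge0.
have undil t q : t != 0 -> sqn q <= c t * sqn (q *m dil t).
  move=> tn0; rewrite -{1}[q]mulmx1 -(dilVK tn0) mulmxA -form_gram.
  exact: le_trans (ler_norm _) (form_bound _ _).
pose b2 := \sum_k (c (t0 k) + c (t1 k) * (rho ^+ 2 + 1)).
have rho2 : 0 <= rho ^+ 2 by exact: sqr_ge0.
have term0 k : 0 <= c (t0 k) + c (t1 k) * (rho ^+ 2 + 1).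
  by rewrite addr_ge0 // mulr_ge0 // addr_ge0.
have b20 : 0 <= b2 by apply: sumr_ge0 => k _; exact: term0.
have le_b2 k : c (t0 k) + c (t1 k) * (rho ^+ 2 + 1) <= b2.
  by rewrite /b2 (bigD1 k) //= lerDl; apply: sumr_ge0 => j _; exact: term0.
pose Om' := Om `&` [set p | sqn p <= b2].
have sub t : dilate t Om' `<=` dilate t Om by move=> _ [q [Omq _] <-]; exists q.
apply: (HK0 Om' b2 K t0 t1 P) => //.
- move=> u v s t [Omu bu] [Omv bv] st; split; first exact: cOm.
  pose b := Num.sqrt b2; have bE : b2 = b ^+ 2 by rewrite sqr_sqrtr.
  have bge0 : 0 <= b by exact: sqrtr_ge0.
  have bs (a : R) (z : 'rV[R]_N) : sqn z <= b2 -> sqn (a *: z) <= (`|a| * b) ^+ 2.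
    by move=> bw; rewrite sqnZ exprMn real_normK ?num_real // -bE ler_wpM2l ?sqr_ge0.
  have sb (a : R) : 0 <= `|a| * b by rewrite mulr_ge0.
  have := sqn_triangle (sb s) (sb t) (bs s u bu) (bs t v bv).
  move=> h; apply: le_trans h _; rewrite -mulrDl exprMn -bE ler_piMl //.
  by rewrite expr_le1 // addr_ge0.
- by move=> p [].
- move=> k; have [cov bd] := sat k; have /andP[t0k _] := t01 k; split.
    move=> b /cov[_ [[q Omq <-] sq qP]]; exists (q *m dil (t0 k)); split=> //.
    exists q => //; split=> //=; apply: le_trans (undil (t0 k) q _) _.
      by rewrite gt_eqF.
    apply: (@le_trans _ _ (c (t0 k))); first by rewrite ler_piMr.
    apply: le_trans (le_b2 k); rewrite lerDl mulr_ge0 // addr_ge0 //.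
  by move=> p /sub Omp; exact: bd.
- move=> k [cov bd]; apply: (fail k); have /andP[t0k t1k] := t01 k; split.
    by move=> b /cov[p [/sub Omp sp pP]]; exists p.
  move=> p Omp pP; rewrite leNgt; apply/negP; rewrite -/rho => big.
  have sp_gt0 : 0 < sqn p by apply: le_lt_trans big.
  pose a := Num.min 1 (Num.sqrt ((rho ^+ 2 + 1) / sqn p)).
  have a0 : 0 <= a by rewrite le_min ler01 sqrtr_ge0.
  have a1 : a <= 1 by rewrite ge_min lexx.
  have q0 : 0 <= (rho ^+ 2 + 1) / sqn p by rewrite divr_ge0 ?addr_ge0 ?sqn_ge0.
  have sa : sqn (a *: p) <= rho ^+ 2 + 1.
    rewrite sqnZ -ler_pdivlMr // -[leRHS]sqr_sqrtr // lerXn2r ?nnegrE ?sqrtr_ge0 //.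
    by rewrite ge_min lexx orbT.
  suff : rho ^+ 2 < sqn (a *: p).
    rewrite ltNge => /negP; apply; apply: bd; last by rewrite -scalemxAl pP.
    case: Omp => q Omq pE; exists (a *: q); last by rewrite -scalemxAl pE.
    split.
      rewrite -[a *: q]addr0 -(scale0r q); apply: cOm => //.
      by rewrite normr0 addr0 ger0_norm.
    rewrite /=; apply: le_trans (undil (t1 k) _ _) _.
      by rewrite gt_eqF // (lt_le_trans t0k).
    rewrite -scalemxAl pE; apply: le_trans (le_b2 k).
    by apply: le_trans (ler_wpM2l (c0 _) sa) _; rewrite lerDr.
  rewrite sqnZ /a; have [h|h] := leP 1 (Num.sqrt ((rho ^+ 2 + 1) / sqn p)).
    by rewrite expr1n mul1r.
  by rewrite sqr_sqrtr // divfK ?gt_eqF // ltrDl.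
Qed.

End Chains.

(** * Coordinates on the space of polynomials *)

Section ChainRule.
Context (R : realType) (n : nat).

Lemma mderivXU i j : ('X_j : {mpoly R[n]})^`M(i) = (i == j)%:R.
Proof.
rewrite mderivX mnm1E eq_sym; case: eqVneq => [->|_]; last by rewrite scale0r.
rewrite scale1r (_ : (U_(j) - U_(j))%MM = 0%MM) ?mpolyX0 //.
by apply/mnmP => k; rewrite mnmBE subnn mnm0E.
Qed.

(** The hypothesis says that the substitution is affine with linear part [d]. The
    identity passes to products, so it suffices to check constants and
    variables. *)
Lemma mderiv_comp_dilation (lq : n.-tuple {mpoly R[n]}) (d : R) :
  (forall i j, (tnth lq j)^`M(i) = (d *+ (i == j))%:MP) ->
  forall p i, (p \mPo lq)^`M(i) = d *: (p^`M(i) \mPo lq).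
Proof.
move=> dlq.
pose Q (p : {mpoly R[n]}) := forall i, (p \mPo lq)^`M(i) = d *: (p^`M(i) \mPo lq).
have QC c : Q c%:MP.
  by move=> i; rewrite comp_mpolyC !mderivC comp_mpoly0 scaler0.
have QM p q : Q p -> Q q -> Q (p * q).
  move=> Qp Qq i; rewrite rmorphM /= !mderivM Qp Qq comp_mpolyD !rmorphM /=.
  by rewrite scalerDr scalerAl scalerAr.
have QX i : Q 'X_i.
  move=> j; rewrite comp_mpolyXU -tnth_nth dlq mderivXU rmorph_nat.
  by case: eqP; rewrite ?scaler0 ?mulr0n ?mpolyC0 // mulr1n alg_mpolyC.
refine (@mpolyind n R Q _ _) => [|c m p _ _ Qp]; first exact: QC 0.
move=> i; rewrite !(comp_mpolyD, mderivD) Qp scalerDr; congr (_ + _); move: i.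
rewrite -mul_mpolyC; apply: (QM _ _ (QC c)); rewrite mpolyXE_id.
have Q1 : Q 1 by rewrite -mpolyC1; exact: QC.
apply: (big_ind Q Q1 QM) => i _.
elim: (m i) => [|k IHk]; first by rewrite expr0.
by rewrite exprS; apply: (QM _ _ (QX i)).
Qed.

Lemma mderivm_comp_dilation (lq : n.-tuple {mpoly R[n]}) (d : R) :
  (forall i j, (tnth lq j)^`M(i) = (d *+ (i == j))%:MP) ->
  forall p a, (p \mPo lq)^`M[a] = d ^+ mdeg a *: (p^`M[a] \mPo lq).
Proof.
move=> /mderiv_comp_dilation dlq p a.
rewrite mdegE -[X in d ^+ X]big_enum /mderivm; elim: (enum _) => [|i s IHs] /=.
  by rewrite big_nil expr0 scale1r.
rewrite big_cons exprD IHs; elim: (a i) => [|k IHk] /=; first by rewrite mul1r.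
by rewrite IHk mderivZ dlq scalerA exprS; congr (_ *: _); ring.
Qed.

End ChainRule.

Section Coordinates.
Context (R : realType) (m n : nat).
Notation idx := 'X_{1..n < m}.
Notation N := #|{: idx}|.
Implicit Types (x : 'rV[R]_n) (P Q : polysp R m n) (V : {vspace polysp R m n}).

Definition mon (i : 'I_N) : idx := enum_val i.

(** Coordinates in which [dotp x] is the standard dot product. *)
Definition coordp x P : 'rV[R]_N :=
  \row_i ((Num.sqrt (mfact (mon i))%:R)^-1 * P^`M[mon i].@[x 0]).

Lemma mfact_gt0 (a : 'X_{1..n}) : (0 < mfact a)%N.
Proof. by rewrite prodn_gt0 // => i; rewrite fact_gt0. Qed.

Fact coordp_linear x : linear (coordp x).
Proof.
move=> c P Q; apply/rowP => i; rewrite !mxE /=.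
by rewrite mderivmD mderivmZ mevalD mevalZ; ring.
Qed.

HB.instance Definition _ x :=
  GRing.isLinear.Build R (polysp R m n) 'rV[R]_N *:%R (coordp x) (coordp_linear x).

Lemma dotp_coordp x P Q : dotp x P Q = dot (coordp x P) (coordp x Q).
Proof.
rewrite /dotp dotE; rewrite (eq_bigl (mem predT)) // big_enum_val.
apply: eq_bigr => i _; rewrite !mxE -/(mon i).
set f := _%:R; have f0 : 0 < f by rewrite ltr0n mfact_gt0.
have -> : f^-1 = (Num.sqrt f)^-1 * (Num.sqrt f)^-1.
  by rewrite -invfM -expr2 sqr_sqrtr // ltW.
by ring.
Qed.

Definition weight (i : 'I_N) : nat := (m - mdeg (mon i))%N.

Lemma coordp_tau x d P : d != 0 ->
  coordp x (tau x d P) = coordp x P *m dil weight d^-1.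
Proof.
move=> d0; apply/rowP => i; rewrite mul_mx_diag !mxE -mulrA; congr (_ * _).
have der k l : (tnth (dilation_subst x d) l)^`M(k) = (d *+ (k == l))%:MP.
  rewrite tnth_mktuple mderivD mderivC add0r mderivZ mderivB mderivC subr0.
  by rewrite mderivXU; case: eqP; rewrite ?scaler0 ?mulr0n ?mpolyC0 // mulr1n alg_mpolyC.
rewrite mderivmZ mevalZ (mderivm_comp_dilation der) mevalZ comp_mpoly_meval.
have -> : P^`M[mon i].@[fun k => (tnth (dilation_subst x d) k).@[x 0]]
    = P^`M[mon i].@[x 0].
  apply: meval_eq => k; rewrite tnth_mktuple.
  by rewrite mevalD mevalC mevalZ mevalB mevalXU mevalC subrr mulr0 addr0.
rewrite mulrA mulrC; congr (_ * _); rewrite /weight exprVn.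
have le : (mdeg (mon i) <= m)%N by exact: ltnW (bmdeg _).
by rewrite expfB_cond ?(negbTE d0) ?addn0 // invf_div mulrC.
Qed.

(** The derivative along the leading monomial of a nonzero polynomial is a
    nonzero constant. *)
Lemma coordp_inj x : injective (coordp x).
Proof.
apply: raddf_inj => P P0; apply/val_inj => /=; apply/eqP/contraT => Pn0.
have sa : (mdeg (mlead P) < m)%N.
  by rewrite -ltnS mlead_deg // ltnS msize_polysp.
have : coordp x P 0 (enum_rank (BMultinom sa)) = 0 by rewrite P0 mxE.
rewrite mxE /mon enum_rankK /=.
have -> : (P : {mpoly R[n]})^`M[mlead P] =
    (mleadc P *+ \prod_(i < n) (mlead P i) ^_ (mlead P i))%:MP.
  apply/mpolyP => k; rewrite mcoeff_mderivm mcoeffC.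
  have [->|k0] := eqVneq k 0%MM.
    by rewrite addm0 mulr1.
  rewrite memN_msupp_eq0 ?mul0rn ?mulr0 //; apply: msize_mdeg_ge.
  rewrite -mlead_deg // mdegD -addn1 leq_add2l lt0n mdeg_eq0.
  exact: k0.
rewrite mevalC => /eqP; rewrite mulf_eq0 invr_eq0 sqrtr_eq0 lern0.
rewrite eqn0Ngt mfact_gt0 /= -mulr_natr mulf_eq0 mleadc_eq0 (negbTE Pn0) /=.
rewrite pnatr_eq0 => /eqP p0; have : (0 < \prod_(i < n) (mlead P i) ^_ (mlead P i))%N.
  by rewrite prodn_gt0 // => i; rewrite ffact_gt0.
by rewrite p0.
Qed.

Lemma dim_polysp : \dim {: polysp R m n} = N.
Proof. by rewrite dimvf. Qed.

Lemma coordp_surj x v : exists P, coordp x P = v.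
Proof.
pose f := linfun (coordp x).
have fE P : f P = coordp x P by rewrite lfunE.
have k0 : (fullv :&: lker f)%VS = 0%VS.
  apply/eqP; rewrite capfv -subv0; apply/subvP => P; rewrite memv_ker memv0 fE.
  by rewrite -[X in _ == X](raddf0 (coordp x)) => /eqP/coordp_inj ->.
have limgT : limg f = fullv.
  apply/eqP; rewrite eqEdim subvf (limg_dim_eq k0) dim_polysp dimvf /dim /=.
  by rewrite mul1n.
have /memv_imgP[P _ ->] : v \in limg f by rewrite limgT memvf.
by exists P.
Qed.

Lemma orthoproj_vspace x V : exists2 Pi, orthoproj Pi &
  forall P, P \in V <-> coordp x P *m Pi = coordp x P.
Proof.
pose U := \matrix_(i < \dim V) coordp x (vbasis V)`_i.
have [Pi oPi PiP] := orthoproj_exists <<U>>%MS; exists Pi => // P.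
rewrite -PiP genmxE; split => [PV|/submxP[c cE]].
  rewrite (coord_vbasis PV) linear_sum /=; apply: summx_sub => i _.
  rewrite linearZ /= scalemx_sub // (_ : coordp x _ = row i U) ?row_sub //.
  by rewrite rowK.
suff -> : P = \sum_(i < \dim V) c 0 i *: (vbasis V)`_i.
  apply: memv_suml => i _; apply/memvZ/vbasis_mem/mem_nth.
  by rewrite size_tuple.
apply: (@coordp_inj x); rewrite cE mulmx_sum_row linear_sum /=.
by apply: eq_bigr => i _; rewrite linearZ /= rowK.
Qed.

Lemma dil1 : dil weight 1 = 1%:M :> 'M[R]_N.
Proof.
rewrite /dil -diag_const_mx; congr diag_mx; apply/rowP => i.
by rewrite !mxE expr1n.
Qed.

Lemma sball1 x P : sball x 1 P <-> sqn (coordp x P) <= 1.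
Proof.
rewrite /sball /= /snorm /sdotp dotp_coordp coordp_tau ?oner_neq0 //.
rewrite invr1 dil1 mulmx1 -/(sqn _) -[X in _ <= X]sqrtr1.
by rewrite ler_psqrt ?nnegrE // ?sqn_ge0.
Qed.

Lemma transverse_coordp x d r (Om : set (polysp R m n)) V Pi : 0 < d -> 0 < r ->
  (forall P, P \in V <-> coordp x P *m Pi = coordp x P) ->
  transverse x 1 r (tau x d @` Om) V <->
  transverse_to (dilate weight d^-1 (coordp x @` Om)) r Pi.
Proof.
move=> d0 r0 PiP; have dn0 : d != 0 by rewrite gt_eqF.
have imE p : dilate weight d^-1 (coordp x @` Om) p <->
    exists2 P, (tau x d @` Om) P & coordp x P = p.
  split=> [[_ [P OmP <-] <-]|[_ [P OmP <-] <-]].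
    by exists (tau x d P); [exists P | rewrite coordp_tau].
  by exists (coordp x P); [exists P | rewrite coordp_tau].
split=> -[cov bd]; split.
- move=> b b1; have [P PE] := coordp_surj x b; rewrite -PE in b1 *.
  have [|_ [Q [OmQ /sball1 Q1] <-] E] := cov [set Q | Q - P \in V].
    by exists P => //; exact/sball1.
  exists (coordp x Q); split=> //; first by apply/imE; exists Q.
  rewrite -linearZ -linearB; apply/PiP.
  have : [set T | T - P \in V] P by rewrite /= subrr mem0v.
  by rewrite -E.
- move=> _ /imE[P OmP <-] /PiP PV; have [|Q /sball1 Q1 <-] := bd P; first by split.
  by rewrite linearZ /= sqnZ ler_piMr // sqr_ge0.
- move=> _ [P /sball1 P1 <-]; have [p [/imE[Q OmQ <-] Q1]] := cov _ P1.
  rewrite -linearZ -linearB => /PiP PQ.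
  exists (r *: Q); first by exists Q => //; split=> //; apply/sball1.
  have shift T : (T - r *: Q \in V) = (T - P \in V).
    by rewrite -(rpredDr (T - P) PQ) addrA subrK.
  by apply/seteqP; split=> T /=; rewrite shift.
- move=> P [OmP /= PV]; exists (r^-1 *: P); last by rewrite scalerA mulfV ?gt_eqF // scale1r.
  apply/sball1; rewrite linearZ /= sqnZ exprVn mulrC ler_pdivrMr ?exprn_gt0 // mul1r.
  by apply: bd; [apply/imE; exists P | apply/PiP].
Qed.

End Coordinates.

(** * Absolute convexity of the jets *)

Section Jets.
Context (R : realType) (n : nat).
Implicit Types (F G : 'rV[R]_n -> R) (s t : R).

Definition comb s t F G : 'rV[R]_n -> R := fun x => s * F x + t * G x.

Lemma partial_comb i s t F G :
  (forall x, derivable F x (delta_mx 0 i)) ->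
  (forall x, derivable G x (delta_mx 0 i)) ->
  (forall x, derivable (comb s t F G) x (delta_mx 0 i)) /\
  partial i (comb s t F G) = comb s t (partial i F) (partial i G).
Proof.
move=> dF dG.
have E : comb s t F G = (s \*: F) + (t \*: G) by [].
split=> [x|]; first by rewrite E; apply: derivableD; apply: derivableZ.
apply: funext => x; rewrite /partial E.
rewrite deriveD ?(deriveZ _ (dF x)) ?(deriveZ _ (dG x)) //; exact: derivableZ.
Qed.

Lemma Cfun_comb k s t F G : Cfun k F -> Cfun k G -> Cfun k (comb s t F G).
Proof.
have cont F' G' : continuous F' -> continuous G' -> continuous (comb s t F' G').
  move=> cF cG x; have FF : Filter (nbhs x) by exact: (@nbhs_filter 'rV[R]_n x).
  exact: cvgD (cvgMl_tmp (cF x)) (cvgMl_tmp (cG x)).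
elim: k F G => [|k IHk] F G /=; first exact: cont.
move=> [cF dF] [cG dG]; split=> [|i]; first exact: cont.
have [dFi CF] := dF i; have [dGi CG] := dG i.
have [dc ->] := partial_comb s t dFi dGi.
by split=> //; exact: IHk.
Qed.

Lemma Cfun_iter k c i F :
  Cfun (k + c) F -> Cfun k (iter c (partial i) F).
Proof.
elim: c k => [|c IHc] k /=; first by rewrite addn0.
by rewrite addnS -addSn => /IHc[_ /(_ i)[]].
Qed.

Lemma iter_partial_comb k c i s t F G : Cfun (k + c) F -> Cfun (k + c) G ->
  iter c (partial i) (comb s t F G)
  = comb s t (iter c (partial i) F) (iter c (partial i) G).
Proof.
elim: c k => [|c IHc] k //=; rewrite addnS -addSn => CF CG.
rewrite (IHc k.+1) //.
have [_ /(_ i)[dF _]] := Cfun_iter i CF; have [_ /(_ i)[dG _]] := Cfun_iter i CG.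
by have [_ ->] := partial_comb s t dF dG.
Qed.

Lemma mpartial_comb k (a : 'X_{1..n}) s t F G : (mdeg a <= k)%N ->
  Cfun k F -> Cfun k G ->
  mpartial a (comb s t F G) = comb s t (mpartial a F) (mpartial a G).
Proof.
move=> ak CF CG.
have foldC l q (H : 'rV[R]_n -> R) : Cfun (q + \sum_(i <- l) a i) H ->
    Cfun q (foldr (fun i H => iter (a i) (partial i) H) H l).
  elim: l q H => [|i l IHl] q H /=; first by rewrite big_nil addn0.
  by rewrite big_cons addnA => CH; exact (Cfun_iter i (IHl _ _ CH)).
suff fold_comb l q : Cfun (q + \sum_(i <- l) a i) F ->
    Cfun (q + \sum_(i <- l) a i) G ->
    foldr (fun i H => iter (a i) (partial i) H) (comb s t F G) l
    = comb s t (foldr (fun i H => iter (a i) (partial i) H) F l)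
               (foldr (fun i H => iter (a i) (partial i) H) G l).
  have ka : (k - mdeg a + \sum_(i <- enum 'I_n) a i)%N = k.
    by rewrite big_enum -mdegE subnK.
  by apply: (fold_comb _ (k - mdeg a)%N); rewrite ka.
elim: l q => [|i l IHl] q //=; rewrite big_cons addnA => HF HG.
by rewrite (IHl _ HF HG) (iter_partial_comb (k := q)) //; exact: foldC.
Qed.

Lemma jet_comb m x s t F G : Cfun m.-1 F -> Cfun m.-1 G ->
  jet m x (comb s t F G) = s *: jet m x F + t *: jet m x G.
Proof.
move=> CF CG; apply/val_inj => /=; rewrite !scaler_sumr -big_split /=.
apply: eq_bigr => a _; rewrite (mpartial_comb (k := m.-1)) //; last first.
  by rewrite -ltnS (leq_trans (bmdeg a)) // leqSpred.
by rewrite !scalerA -scalerDl /comb; congr (_ *: _); ring.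
Qed.

Lemma Clip_seminorm_le1 m F : (Clip_seminorm m F <= 1)%E <->
  forall y z, y <> z ->
    \sum_(a : 'X_{1..n < m} | mdeg a == m.-1)
      (mpartial a F y - mpartial a F z) ^+ 2 / enorm (y - z) ^+ 2 <= 1.
Proof.
have s0 y z : 0 <= \sum_(a : 'X_{1..n < m} | mdeg a == m.-1)
      (mpartial a F y - mpartial a F z) ^+ 2 / enorm (y - z) ^+ 2.
  by apply: sumr_ge0 => a _; rewrite divr_ge0 ?sqr_ge0.
split=> [le1 y z yz|le1].
  rewrite -(@ler_psqrt _ _ 1) ?nnegrE // sqrtr1 -lee_fin; apply: le_trans le1.
  by apply: ereal_sup_ubound; exists (y, z).
apply: ge_ereal_sup => _ [[y z] /= yz <-]; rewrite lee_fin.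
by rewrite -[leRHS]sqrtr1 ler_psqrt ?nnegrE // le1.
Qed.

(** Convexity of the square replaces the triangle inequality. *)
Lemma Clip_comb m s t F G : `|s| + `|t| <= 1 -> Clip m F -> Clip m G ->
  (Clip_seminorm m F <= 1)%E -> (Clip_seminorm m G <= 1)%E ->
  Clip m (comb s t F G) /\ (Clip_seminorm m (comb s t F G) <= 1)%E.
Proof.
move=> st [CF LF] [CG LG] /Clip_seminorm_le1 F1 /Clip_seminorm_le1 G1; split.
  split; first exact: Cfun_comb.
  move=> a am; have [L HL] := LF a am; have [L' HL'] := LG a am.
  exists (`|s| * L + `|t| * L') => x y.
  rewrite (mpartial_comb (k := m.-1)) ?am // /comb.
  rewrite (_ : _ - _ = s * (mpartial a F x - mpartial a F y)
    + t * (mpartial a G x - mpartial a G y)); last by ring.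
  rewrite mulrDl (le_trans (ler_normD _ _)) // !normrM -!mulrA.
  by rewrite lerD // ler_wpM2l.
apply/Clip_seminorm_le1 => y z yz.
apply: (@le_trans _ _ (`|s| * 1 + `|t| * 1)); last by rewrite !mulr1.
apply: (le_trans _ (lerD (ler_wpM2l _ (F1 y z yz)) (ler_wpM2l _ (G1 y z yz)))) => //.
rewrite !mulr_sumr -big_split /=; apply: ler_sum => a am.
rewrite (mpartial_comb (k := m.-1)) ?(eqP am) // /comb.
rewrite !mulrA -mulrDl ler_wpM2r ?invr_ge0 ?sqr_ge0 //.
set u := mpartial a F y; set u' := mpartial a F z.
set v := mpartial a G y; set v' := mpartial a G z.
rewrite (_ : _ - _ = s * (u - u') + t * (v - v')); last by ring.
move: (u - u') (v - v') => {u u' v v'} u v.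
have sE := real_normK (num_real s); have tE := real_normK (num_real t).
have st_le : s * t * (u * v) *+ 2 <= `|s| * `|t| * (u ^+ 2 + v ^+ 2).
  apply: le_trans (ler_norm _) _; rewrite normrMn !normrM -mulrnAr.
  apply: ler_wpM2l; first by rewrite mulr_ge0.
  rewrite -(real_normK (num_real u)) -(real_normK (num_real v)).
  have := sqr_ge0 (`|u| - `|v|); rewrite !expr2; lra.
have u0 := sqr_ge0 u; have v0 := sqr_ge0 v.
have s0 := normr_ge0 s; have t0 := normr_ge0 t.
have e1 : `|s| * (`|s| + `|t|) * u ^+ 2 <= `|s| * u ^+ 2.
  by rewrite ler_wpM2r // ler_piMr.
have e2 : `|t| * (`|s| + `|t|) * v ^+ 2 <= `|t| * v ^+ 2.
  by rewrite ler_wpM2r // ler_piMr.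
rewrite (_ : (s * u + t * v) ^+ 2 = `|s| ^+ 2 * u ^+ 2 + `|t| ^+ 2 * v ^+ 2
   + s * t * (u * v) *+ 2); last by rewrite sE tE; ring.
by rewrite !expr2 in st_le e1 e2 *; lra.
Qed.

Lemma sigma_absconvex m (E : set 'rV[R]_n) x P Q s t :
  sigma m E x P -> sigma m E x Q -> `|s| + `|t| <= 1 ->
  sigma m E x (s *: P + t *: Q).
Proof.
move=> [F [CF F0 F1] <-] [G [CG G0 G1] <-] st.
have [Cc c1] := Clip_comb st CF CG F1 G1.
exists (comb s t F G); last by case: CF CG => [CF _] [CG _]; exact: jet_comb.
by split=> // e Ee; rewrite /comb F0 // G0 // !mulr0 addr0.
Qed.

End Jets.

(** * The bound on the complexity *)

Theorem lemma1p3 (R : realType) (m n : nat) (hm : (1 <= m)%N) (hn : (1 <= n)%N)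
    (c1 R0 : R) (hc1 : 0 < c1 <= 1) (hR0 : 1 <= R0)
    (transverse_nearby :
       forall (E : set 'rV[R]_n) (V : {vspace polysp R m n})
              (x y : 'rV[R]_n) (d r : R),
         finite_set E -> 0 < d -> 1 <= r ->
         transverse x d r (sigma m E x) V ->
         enorm (x - y) <= c1 * d / r ->
         transverse y d (8 * r) (sigma m E y) V)
    (transverse_DTI :
       forall (E : set 'rV[R]_n) (x : 'rV[R]_n) (d : R),
         finite_set E -> 0 < d ->
         exists V : {vspace polysp R m n},
           DTI V /\ transverse x d R0 (sigma m E x) V) :
  exists K0 : nat,
    forall E : set 'rV[R]_n, finite_set E ->
      (complexity m c1 R0 E <= K0%:R%:E)%E.
Proof.
pose w := @weight m n; pose D := #|{: 'X_{1..n < m}}|.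
have D1 : 1 <= D%:R :> R.
  rewrite ler1n; apply/card_gt0P.
  have a0 : (mdeg (0%MM : 'X_{1..n}) < m)%N by rewrite mdeg0.
  by exists (BMultinom a0).
have w_le i : (w i <= m)%N by exact: leq_subr.
have rl1 : 1 <= R_label R0 by rewrite /R_label; lra.
have [K0 HK0] := chain_bound w_le D1 (lexx _) rl1.
exists K0 => E _; apply: ge_ereal_sup => _ [x _ <-].
apply: ge_ereal_sup => _ [K [I [V [Iord Ilt Itr]]] <-].
rewrite lee_fin ler_nat.
have /choice[Pi PiP] : forall k, exists Pi, orthoproj Pi /\
    forall P, P \in V k <-> coordp x P *m Pi = coordp x P.
  by move=> k; have [Pi ? ?] := orthoproj_vspace x (V k); exists Pi.
have I1 k : 0 < (I k).1 by have [] := Iord k.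
have I2 k : 0 < (I k).2 by have [h1 h2 _] := Iord k; exact: lt_le_trans h2.
have medE : R_med m n R0 = 256 * D%:R * R_label R0 by rewrite /R_med dim_polysp.
apply: (HK0 (coordp x @` sigma m E x) K (fun k => (I k).2^-1)
  (fun k => (I k).1^-1) Pi).
- move=> _ _ s t [P sP <-] [Q sQ <-] st; exists (s *: P + t *: Q).
    exact: sigma_absconvex.
  by rewrite linearD !linearZ.
- by move=> k; have [] := PiP k.
- move=> k; have [h1 h2 _] := Iord k.
  by rewrite invr_gt0 I2 /= lef_pV2 ?posrE.
- have ord (j k : 'I_K) : (j < k)%N -> (I j).1^-1 <= (I k).2^-1.
    move=> /Ilt h; rewrite lef_pV2 ?posrE //.
    by case: h => [/ltW|[-> _]].
  by move=> j k; rewrite neq_ltn => /orP[/ord|/ord]; [left | right].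
- move=> k; have [sat _] := Itr k; have [_ Pk] := PiP k.
  by apply/(transverse_coordp _ _ _ Pk) => //; lra.
- move=> k; have [_ fail] := Itr k; have [_ Pk] := PiP k; rewrite -medE.
  have med0 : 0 < R_med m n R0 by rewrite medE; apply: mulr_gt0; lra.
  by move=> /(transverse_coordp _ (I1 k) med0 Pk).
Qed.
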